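(* Let $B$ be a separable Banach space, $\gamma\in\mathcal{P}_1(B)$ and $n\in\mathbb{N}$, $n\geq1$. The set $$\mathcal{P}^{(n)}_{\mathrm{cx}}(\gamma):=\{\zeta\in\mathcal{P}_1(B):\ |\mathrm{supp}(\zeta)|\leq n,\ \zeta\leq_{\mathrm{cx}}\gamma\}$$ coincides with the set of barycentric quantisations of $\gamma$ with respect to $(\pi,\Pi_1,\{B\})$, where $\Pi_1$ spans all (Borel) partitions of $B$ made of at most $n$ elements and $\pi$ spans all Borel probabilities on $B\times B$ whose second marginal is $\gamma$.
   Context: $\mathcal{P}_1(B)$ is the set of Borel probabilities on $B$ with finite first moment. $\zeta\leq_{\mathrm{cx}}\gamma$ means $\int f\,d\zeta\leq\int f\,d\gamma$ for every Lipschitz convex $f:B\to\mathbb{R}$. Barycentric quantisation: given $\gamma,\zeta\in\mathcal{P}_1(B)$ with $\zeta$ finitely-supported, a Borel probability $\pi$ on $B\times B$ whose second marginal is $\gamma$, and finite partitions $\Pi_1=(P_{1,i})_{i\in I}$, $\Pi_2=(P_{2,j})_{j\in J}$ of $B$ made of Borel sets, $\zeta$ is called the barycentric quantisation of $\gamma$ with respect to $(\pi,\Pi_1,\Pi_2)$ if $$\zeta=\sum_{i\in I,\,j\in J:\ \pi_{i,j}>0}\pi_{i,j}\,\delta_{y_{i,j}},\qquad \pi_{i,j}:=\pi(P_{1,i}\times P_{2,j}),\qquad y_{i,j}:=\frac{1}{\pi_{i,j}}\int_{P_{1,i}\times P_{2,j}}y\,\pi(dx,dy).$$ *)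

(* Defs.v *)
From HB Require Import structures.
From mathcomp Require Export all_boot all_order all_algebra.
From mathcomp Require Export all_classical all_reals all_analysis.

Set Implicit Arguments.
Unset Strict Implicit.
Unset Printing Implicit Defensive.

Export Order.TTheory GRing.Theory Num.Theory.
Export numFieldNormedType.Exports.

#[export] Set Implicit Arguments.
#[export] Unset Strict Implicit.
#[export] Unset Printing Implicit Defensive.

Global Open Scope classical_set_scope.
Global Open Scope ring_scope.

(* The carrier T with its Borel sigma-algebra.  [borel (B * B)] is generated by
   the open sets of the product topology. *)
Notation borel T := (g_sigma_algebraType (@open T%type)).

Definition separable (T : topologicalType) : Prop :=
  exists2 D : set T, countable D & dense D.

Section bochner.
Context (d : measure_display) (T : measurableType d) (R : realType)
  (B : completeNormedModType R).

Definition simple_fun (s : T -> B) : Prop :=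
  measurable_fun [set: T] (s : T -> borel B) /\ finite_set (range s).

Definition simple_integral (mu : {finite_measure set T -> \bar R}) (D : set T)
    (s : T -> B) : B :=
  \sum_(v \in range s) fine (mu (D `&` s @^-1` [set v])) *: v.

Definition is_bochner_integral (mu : {finite_measure set T -> \bar R})
    (D : set T) (f : T -> B) (v : B) : Prop :=
  measurable_fun D (f : T -> borel B) /\
  exists s : nat -> T -> B,
    [/\ forall k, simple_fun (s k),
        (fun k => \int[mu]_(x in D) (`|f x - s k x|)%:E)%E @ \oo --> 0%E
      & (fun k => simple_integral mu D (s k)) @ \oo --> v].

(* Bochner integral of f over D; junk value 0 if f is not Bochner integrable. *)
Definition bochner_integral (mu : {finite_measure set T -> \bar R})
    (D : set T) (f : T -> B) : B :=
  xget 0 (is_bochner_integral mu D f).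

End bochner.

Section definitions.
Context (R : realType) (B : completeNormedModType R).

Definition finite_first_moment : set (probability (borel B) R) :=
  [set mu : probability (borel B) R | (\int[mu]_x (`|x : B|)%:E < +oo)%E].

Definition supp (mu : probability (borel B) R) : set B :=
  [set x | forall U : set B, open U -> U x -> (0 < mu U)%E].

Definition convex_le (zeta gamma : probability (borel B) R) : Prop :=
  forall f : B -> R^o, lipschitz f -> convex_function [set: B] f ->
    (\int[zeta]_x (f x)%:E <= \int[gamma]_x (f x)%:E)%E.

Definition borel_partition (I : finType) (P : I -> set B) : Prop :=
  partition [set: I] P [set: B] /\
  forall i, measurable (P i : set (borel B)).

Definition second_marginal (pi : probability (borel (B * B)) R)
    (gamma : probability (borel B) R) : Prop :=
  forall A : set (borel B), measurable A ->
    pushforward pi (snd : borel (B * B) -> borel B) A = gamma A.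

(* The mean of the second coordinate y under pi conditioned on C. *)
Definition barycentre (pi : probability (borel (B * B)) R) (C : set (B * B))
    : B :=
  (fine (pi C))^-1 *:
    bochner_integral pi C (snd : borel (B * B) -> B).

Definition barycentric_quantisation (gamma : probability (borel B) R)
    (pi : probability (borel (B * B)) R) (I J : finType)
    (P1 : I -> set B) (P2 : J -> set B)
    (zeta : probability (borel B) R) : Prop :=
  [/\ finite_first_moment gamma,
      finite_first_moment zeta /\ finite_set (supp zeta),
      second_marginal pi gamma,
      borel_partition P1 /\ borel_partition P2
    & forall A : set (borel B), measurable A ->
        zeta A =
        (\sum_(ij : I * J | (0 < pi (P1 ij.1 `*` P2 ij.2))%E)
           pi (P1 ij.1 `*` P2 ij.2) *
           dirac (barycentre pi (P1 ij.1 `*` P2 ij.2) : borel B) A)%E].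

Definition P_cx (n : nat) (gamma : probability (borel B) R)
    : set (probability (borel B) R) :=
  [set zeta : probability (borel B) R | [/\ finite_first_moment zeta,
                  (supp zeta #<= `I_n)%card
                & convex_le zeta gamma]].

End definitions.

(* Main.v *)
From HB Require Import structures.
From mathcomp Require Import finmap.
Require Import Defs.
From mathcomp Require Import measurable_realfun ring lra.

(** A barycentric quantisation zeta of gamma replaces each cell of a partition
    by one atom, placed at the mean of y over the cell.  By Jensen's inequality
    on each cell, the integral of a convex Lipschitz F against zeta is at most
    that of F(y) against pi, which is the integral of F against gamma.  So
    zeta is below gamma in the convex order, and it has at most one atom per
    cell (quantisation_P_cx).

    Conversely, let zeta have atoms v_1, ..., v_m of masses p_1, ..., p_m, with
    m at most n, and lie below gamma in the convex order.  A finite form of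
    Strassen's theorem splits gamma into a sum of measures nu_i of mass p_i and
    mean v_i (strassen).  Then pi, the sum of the products of the Dirac mass at
    v_i with nu_i, has second marginal gamma (coupling), and a partition of B
    which separates the v_i recovers the nu_i, hence the v_i, as the
    barycentres of its cells (P_cx_quantisation).

    Strassen's theorem for finitely many atoms is a separation argument.  The
    pairs (mass, mean) of the splittings of gamma form a convex set of finite
    families in R x B.  If the family of the (p_i, p_i v_i) stayed at positive
    distance from it, the Hahn-Banach theorem would provide affine functions
    l_i on B such that the sum of the p_i l_i(v_i) is larger than what any
    splitting of gamma achieves (separation).  Splitting gamma according to
    which l_i is largest achieves the integral of F = max l_i, so that F
    integrates to more under zeta than under gamma, although F is convex and
    Lipschitz.  Hence the family is a limit of pairs coming from splittings,
    and it remains to see that the limit is attained (splitting_closed).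

    Attainment is a weak compactness statement.  The pieces of a splitting are
    treated as finitely additive set functions below gamma: along an
    ultrafilter they converge on every set, and domination by gamma makes the
    limits countably additive (minorant_sigma_additive).  Their means converge
    as well, because the identity of B is approximated in L^1(gamma) by maps
    with finitely many values, and the error is uniform over all set functions
    below gamma (mean_dist).

    The same approximation shows that Bochner integrals exist (bochner_mean).
    Jensen's inequality follows from the existence of subgradients, because
    bounded linear functionals commute with the Bochner integral
    (bochner_linear). *)

(** * The Hahn-Banach theorem and subgradients *)

Section hahn_banach.
Context (R : realType) (E : lmodType R).
Implicit Types (q : E -> R) (G : set (E * R)).

Definition convex_real q := forall (t : R) x y, 0 <= t <= 1 ->
  q (t *: x + (1 - t) *: y) <= t * q x + (1 - t) * q y.

(** Partial linear functionals below q, encoded by their graphs.  The graph is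
    only required to be stable under linear combinations: single-valuedness
    follows from domination, since (0, r) in the graph forces a * r <= q 0 for
    every scalar a.  The empty graph is included so that chains have unions. *)
Definition dominated_graph q G :=
  (forall a u v, G u -> G v -> G (a *: u.1 + v.1, a * u.2 + v.2)) /\
  (forall u, G u -> u.2 <= q u.1).

Lemma dominated_graph_bigcup q (F : set (set (E * R))) :
  F `<=` dominated_graph q -> total_on F subset ->
  dominated_graph q (\bigcup_(X in F) X).
Proof.
move=> Fq Ftot; split => [a u v [X FX Xu] [Y FY Yv]|u [X FX Xu]]; last first.
  exact: (Fq _ FX).2.
have [XY|YX] := Ftot _ _ FX FY.
- by exists Y => //; apply: (Fq _ FY).1 => //; exact: XY.
- by exists X => //; apply: (Fq _ FX).1 => //; exact: YX.
Qed.

(** The extension step of Hahn-Banach: the value c at x0 has to lie above all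
    left slopes of q along x0 and below all right slopes, over all points of
    the graph.  Convexity of q compares any left slope with any right slope, so
    the supremum of the left slopes works. *)
Lemma dominated_graph_slope q G x0 : convex_real q ->
  dominated_graph q G -> G (0, 0) ->
  exists c : R, forall u (a : R), G u -> u.2 + a * c <= q (u.1 + a *: x0).
Proof.
move=> qcvx [Glin Gq] G0.
pose S := [set s : R | exists u (b : R),
  [/\ G u, 0 < b & s = (u.2 - q (u.1 - b *: x0)) / b]].
have key u (b : R) u' (a : R) : G u -> 0 < b -> G u' -> 0 < a ->
    (u.2 - q (u.1 - b *: x0)) / b <= (q (u'.1 + a *: x0) - u'.2) / a.
  move=> Gu b0 Gu' a0.
  have ab0 : 0 < a + b by rewrite addr_gt0.
  rewrite ler_pdivrMr// mulrAC ler_pdivlMr//.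
  have h : (a / (a + b)) * u.2 + (b / (a + b)) * u'.2 <=
      q ((a / (a + b)) *: u.1 + (b / (a + b)) *: u'.1).
    have := Gq _ (Glin (a / (a + b)) _ _ Gu
      (Glin (b / (a + b)) _ _ Gu' G0)).
    by rewrite /= !addr0.
  have E1 : b / (a + b) = 1 - a / (a + b).
    by rewrite -[in RHS](divff (lt0r_neq0 ab0)) -mulrBl addrAC subrr add0r.
  have t01 : 0 <= a / (a + b) <= 1.
    rewrite divr_ge0 ?(ltW a0) ?(ltW ab0)//=.
    by rewrite ler_pdivrMr// mul1r lerDl ltW.
  have h2 := qcvx (a / (a + b)) (u.1 - b *: x0) (u'.1 + a *: x0) t01.
  have E2 : (a / (a + b)) *: (u.1 - b *: x0) +
      (1 - a / (a + b)) *: (u'.1 + a *: x0) =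
      (a / (a + b)) *: u.1 + (b / (a + b)) *: u'.1.
    rewrite -E1 scalerBr scalerDr !scalerA addrACA.
    rewrite [X in _ + X](_ : _ = 0) ?addr0//.
    by rewrite mulrAC [b / _ * a]mulrAC [b * a]mulrC addNr.
  rewrite E2 in h2.
  have h3 := le_trans h h2; rewrite -E1 in h3.
  have Fa : (a + b) * (a / (a + b)) = a by rewrite mulrC divfK ?lt0r_neq0.
  have Fb : (a + b) * (b / (a + b)) = b by rewrite mulrC divfK ?lt0r_neq0.
  move: h3; rewrite -(ler_pM2l ab0) !mulrDr.
  move: (a / (a + b)) (b / (a + b)) Fa Fb => w w'; rewrite ![(a + b) * (_ * _)]mulrA => -> ->.
  by lra.
have Sne : S ((0 - q (0 - 1 *: x0)) / 1) by exists (0, 0), 1; split.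
have Sub : ubound S ((q (0 + 1 *: x0) - 0) / 1).
  by move=> _ [u [b [Gu b0 ->]]]; apply: (key u b (0, 0) 1).
exists (sup S) => u a Gu.
have [a0|a0|->] := ltgtP a 0; last first.
- by rewrite mul0r scale0r !addr0; exact: Gq.
- have : sup S <= (q (u.1 + a *: x0) - u.2) / a.
    apply: ge_sup; first by eexists; exact: Sne.
    by move=> _ [u' [b [Gu' b0 ->]]]; exact: key.
  by rewrite ler_pdivlMr// => h; rewrite mulrC addrC -lerBrDr.
- have : (u.2 - q (u.1 - (- a) *: x0)) / (- a) <= sup S.
    apply: sup_upper_bound; first by split; [eexists; exact: Sne|eexists; exact: Sub].
    by exists u, (- a); rewrite oppr_gt0.
  rewrite ler_pdivrMr ?oppr_gt0// scaleNr opprK => h.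
  by nra.
Qed.

(** The dominating function is merely convex, not sublinear; with this
    generality the existence of subgradients is a translation of the statement. *)
Lemma hahn_banach q : q 0 = 0 -> convex_real q ->
  exists g : {scalar E}, forall x, g x <= q x.
Proof.
move=> q0 qcvx.
have [G [Gq Gmax]] := Zorn_bigcup (@dominated_graph_bigcup q).
have [Glin Gdom] := Gq.
have G0 : G (0, 0).
  apply: contrapT => nG0; apply: (Gmax (G `|` [set (0, 0)])).
    by split; [move=> ? ?; left|move/(_ (0, 0)); apply: contra_not nG0; apply; right].
  have [->|/set0P[u Gu]] := eqVneq G set0.
    rewrite set0U; split => [a _ _ -> ->|_ ->] /=; last by rewrite q0.
    by rewrite scaler0 mulr0 !addr0.
  case: nG0.
  have := Glin (-1) _ _ Gu Gu.
  by rewrite scaleN1r mulN1r !addNr.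
have Gtot x : exists r, G (x, r).
  apply: contrapT => nGx.
  have [c cP] := dominated_graph_slope x qcvx Gq G0.
  pose G' := [set w : E * R | exists u (a : R),
    G u /\ w = (u.1 + a *: x, u.2 + a * c)].
  apply: (Gmax G').
    split=> [[y r] Gyr|].
      by exists (y, r), 0; rewrite /= scale0r mul0r !addr0.
    move/(_ (x, c)) => /= h; apply: nGx; exists c; apply: h.
    by exists (0, 0), 1; rewrite /= scale1r mul1r !add0r.
  split=> [a _ _ [u [b [Gu ->]]] [v [b' [Gv ->]]]|_ [u [b [Gu ->]]]] /=.
    exists (a *: u.1 + v.1, a * u.2 + v.2), (a * b + b'); split; first exact: Glin.
    rewrite /= scalerDr mulrDr scalerDl mulrDl scalerA mulrA.
    by rewrite addrACA; congr pair; rewrite addrACA.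
  exact: cP.
have /choice[g gP] := Gtot.
suff glin : scalar g.
  pose g' : {scalar E} := HB.pack g (GRing.isLinear.Build R E R *%R g glin).
  by exists g' => x; exact: (Gdom _ (gP x)).
move=> a x y; apply/eqP; rewrite -subr_eq0; apply/eqP.
set r := _ - _.
have Gr : G (0, r).
  have := Glin (-1) _ _ (Glin a _ _ (gP x) (gP y)) (gP (a *: x + y)).
  by rewrite /= scaleN1r mulN1r addNr addrC.
have lem a' : a' * r <= 0.
  by have := Gdom _ (Glin a' _ _ Gr G0); rewrite /= scaler0 !addr0 q0.
by apply/eqP; rewrite eq_le; have := lem 1; have := lem (-1); rewrite mul1r; lra.
Qed.

Lemma subgradient q t : convex_real q ->
  exists g : {scalar E}, forall x, q t + g (x - t) <= q x.
Proof.
move=> qcvx.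
have [|s x y s01|g gq] := @hahn_banach (fun h => q (t + h) - q t).
- by rewrite addr0 subrr.
- have := qcvx s (t + x) (t + y) s01.
  rewrite !scalerDr addrACA -scalerDl addrC.
  have -> : s + (1 - s) = 1 by ring.
  by rewrite scale1r [X in q X]addrC; lra.
- exists g => x.
  by have := gq (x - t); rewrite [t + _]addrCA subrr addr0; lra.
Qed.

End hahn_banach.

(** * Maps with finitely many values and finitely additive set functions *)

Section finitary.
Context (d : measure_display) (T : measurableType d).

(** Measurability is imposed on the fibres, so that W needs no sigma-algebra:
    pairs of simple functions and maps into a finite index type fit as well. *)
Definition finitary (W : choiceType) (t : T -> W) :=
  finite_set (range t) /\ forall w, measurable (t @^-1` [set w]).

(** Source of all measurability facts about expressions that involve a
    finitary map: such a set is glued from finitely many pieces, one for each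
    value of t. *)
Lemma finitary_bigcup (W : choiceType) (t : T -> W) (F : W -> set T) :
  finitary t -> (forall w, measurable (F w)) ->
  measurable [set x | F (t x) x].
Proof.
move=> [ft mt] mF.
rewrite (_ : [set x | F (t x) x] =
  \bigcup_(w in range t) (t @^-1` [set w] `&` F w)).
  by apply: fin_bigcup_measurable => // w _; exact: measurableI.
apply/seteqP; split => [x Fx|x [w _ [/= -> //]]].
by exists (t x) => //; exists x.
Qed.

Lemma finitary_preimage (W : choiceType) (t : T -> W) Y :
  finitary t -> measurable (t @^-1` Y).
Proof.
move=> ft.
have := @finitary_bigcup W t (fun w => [set x | Y w]) ft; apply => w.
have [Yw|Yw] := pselect (Y w).
  by rewrite (_ : [set x | Y w] = setT)//; apply/seteqP; split.
by rewrite (_ : [set x | Y w] = set0)//; apply/seteqP; split.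
Qed.

Lemma finitary_comp (W W' : choiceType) (t : T -> W) (g : W -> W') :
  finitary t -> finitary (g \o t).
Proof.
move=> tP; split; last first.
  by move=> w; rewrite comp_preimage; exact: finitary_preimage.
by rewrite -(image_comp t g); apply: finite_image; exact: tP.1.
Qed.

Lemma finitary_pair (W W' : choiceType) (t : T -> W) (t' : T -> W') :
  finitary t -> finitary t' -> finitary (fun x => (t x, t' x)).
Proof.
move=> [ft mt] [ft' mt']; split.
  apply: sub_finite_set (finite_setX ft ft').
  by move=> _ [x _ <-]; split; exists x.
move=> [w w']; rewrite (_ : _ @^-1` _ = t @^-1` [set w] `&` t' @^-1` [set w']).
  exact: measurableI.
by apply/seteqP; split => [x [<- <-]|x [/= -> ->]].
Qed.

Lemma finitary_measurable_fun2 (W : choiceType) d' (Z : measurableType d')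
    (t : T -> W) (h : T -> W -> Z) : finitary t ->
  (forall w, measurable_fun setT (h ^~ w)) ->
  measurable_fun setT (fun x => h x (t x)).
Proof.
move=> tP mh _ Y mY; rewrite setTI.
have := @finitary_bigcup W t (fun w => [set x | Y (h x w)]) tP; apply => w.
by rewrite -[X in measurable X]setTI; exact: mh.
Qed.

Lemma finitary_measurable_fun (W : choiceType) d' (Z : measurableType d')
    (t : T -> W) (h : W -> Z) : finitary t ->
  measurable_fun setT (fun x => h (t x)).
Proof.
by move=> tP; apply: (@finitary_measurable_fun2 W d' Z t (fun x => h)).
Qed.

End finitary.

Section finadd.
Context (d : measure_display) (T : measurableType d) (R : realType).
Implicit Types nu : set T -> R.

(** Values are real and only measurable sets are constrained.  Finite
    additivity survives pointwise limits; countable additivity does not do so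
    by itself, which is why it is left out. *)
Definition finadd nu :=
  (forall A, measurable A -> 0 <= nu A) /\
  (forall A B, measurable A -> measurable B -> A `&` B = set0 ->
    nu (A `|` B) = nu A + nu B).

Lemma finadd0 nu : finadd nu -> nu set0 = 0.
Proof.
move=> [_ nuU].
by have := nuU set0 set0 measurable0 measurable0 (setI0 _); rewrite setU0; lra.
Qed.

Lemma finadd_bigsetU nu (W : choiceType) (F : W -> set T) (r : seq W) :
  finadd nu -> (forall w, measurable (F w)) -> uniq r ->
  trivIset [set` r] F ->
  nu (\big[setU/set0]_(w <- r) F w) = \sum_(w <- r) nu (F w).
Proof.
move=> nuP mF; elim: r => [_ _|w r ih /= /andP[wr ur] tF].
  by rewrite !big_nil finadd0.
rewrite !big_cons nuP.2 ?ih//.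
- by apply: sub_trivIset tF => v /= vr; rewrite inE vr orbT.
- exact: bigsetU_measurable.
- rewrite big_distrr/= big_seq big1// => v vr.
  move/trivIsetP : tF; apply => //=; rewrite ?mem_head ?inE ?vr ?orbT//.
  by apply: contraNneq wr => ->.
Qed.

Lemma finadd_measure (mu : {finite_measure set T -> \bar R}) D :
  measurable D -> finadd (fun A => fine (mu (D `&` A))).
Proof.
move=> mD; split => [A mA|A B mA mB AB]; first exact: fine_ge0.
rewrite setIUr measureU ?fineD ?fin_num_measure//; try exact: measurableI.
by rewrite setIACA AB setI0.
Qed.

End finadd.

Section csum.
Context (d : measure_display) (T : measurableType d) (R : realType).
Implicit Types nu : set T -> R.

(** The integral of g o t against nu.  Keeping t and g apart lets two simple
    functions be compared on the common refinement given by their pairing. *)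
Definition csum (V : lmodType R) nu (W : choiceType) (t : T -> W) (g : W -> V)
  : V := \sum_(w \in range t) nu (t @^-1` [set w]) *: g w.

(** Change of variables: each fibre of g o t is a finite disjoint union of
    fibres of t. *)
Lemma csum_comp (V : lmodType R) nu (W W' : choiceType) (t : T -> W)
    (g : W -> W') (k : W' -> V) : finadd nu -> finitary t ->
  csum nu (g \o t) k = csum nu t (k \o g).
Proof.
move=> nuP tP; have gtP := finitary_comp g tP.
rewrite /csum !fsbig_finite//=; [|exact: tP.1|exact: gtP.1].
have E v : nu ((g \o t) @^-1` [set v]) = \sum_(w <- fset_set (range t))
    (if g w == v then nu (t @^-1` [set w]) else 0).
  rewrite -big_mkcond/= -big_filter -finadd_bigsetU//; last 3 first.
  - by move=> w; exact: tP.2.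
  - by rewrite filter_uniq.
  - by move=> a b _ _ [x [/= <- <-]].
  congr nu; apply/seteqP; split => [x /= gtx|x].
    rewrite -bigcup_seq; exists (t x) => //=.
    rewrite mem_filter gtx eqxx/= in_fset_set; last exact: tP.1.
    by apply/mem_set; exists x.
  rewrite -bigcup_seq => -[w /=]; rewrite mem_filter => /andP[/eqP <- _] <-.
  by [].
under eq_bigr do rewrite E scaler_suml.
rewrite exchange_big/=; apply: eq_big_seq => w.
rewrite in_fset_set; last exact: tP.1.
move=> /set_mem[x _ xw].
rewrite (bigD1_seq (g w))//=; last first.
  rewrite in_fset_set; last exact: gtP.1.
  by apply/mem_set; exists x => //=; rewrite xw.
rewrite eqxx big1 ?addr0// => v; rewrite eq_sym => /negbTE ->.
by rewrite scale0r.
Qed.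

Lemma csumB (V : lmodType R) nu (W : choiceType) (t : T -> W) (g h : W -> V) :
  finitary t -> csum nu t (fun w => g w - h w) = csum nu t g - csum nu t h.
Proof.
move=> tP; rewrite /csum !fsbig_finite//; try exact: tP.1.
by rewrite -sumrB; apply: eq_bigr => w _; rewrite scalerBr.
Qed.

Lemma csum_norm (V : normedModType R) nu (W : choiceType) (t : T -> W)
    (g : W -> V) : finadd nu -> finitary t ->
  `|csum nu t g| <= csum nu t (fun w => `|g w| : R^o).
Proof.
move=> nuP tP; rewrite /csum !fsbig_finite//; try exact: tP.1.
rewrite (le_trans (ler_norm_sum _ _ _))//; apply: ler_sum => w _.
by rewrite normrZ ger0_norm//; apply: nuP.1; exact: tP.2.
Qed.

Lemma csum_le nu nu' (W : choiceType) (t : T -> W) (g : W -> R^o) :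
  finitary t -> (forall w, 0 <= g w) ->
  (forall A, measurable A -> nu A <= nu' A) -> csum nu t g <= csum nu' t g.
Proof.
move=> tP g0 nn'; rewrite /csum !fsbig_finite//; try exact: tP.1.
by apply: ler_sum => w _; apply: ler_wpM2r => //; apply: nn'; exact: tP.2.
Qed.

Lemma integral_finitary (mu : {finite_measure set T -> \bar R}) D
    (W : choiceType) (t : T -> W) (h : W -> R^o) :
  measurable D -> finitary t ->
  (\int[mu]_(x in D) (h (t x))%:E =
   (csum (fun A => fine (mu (D `&` A))) t h)%:E)%E.
Proof.
move=> mD tP; rewrite /csum fsbig_finite//; last exact: tP.1.
have mF w : measurable (D `&` t @^-1` [set w]).
  by apply: measurableI => //; exact: tP.2.
rewrite [in LHS](_ : D = \big[setU/set0]_(w <- fset_set (range t))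
    (D `&` t @^-1` [set w])); last first.
  rewrite bigsetU_fset_set; last exact: tP.1.
  apply/seteqP; split => [x Dx|x [w _ []]]//.
  by exists (t x) => //; exists x.
rewrite integral_bigsetU_EFin//; last 2 first.
- by move=> a b _ _ [x [[_ /= <-] [_ /= <-]]].
- apply: measurable_funS (@measurableT _ _) _ _ => //.
  exact/measurable_EFinP/finitary_measurable_fun.
rewrite -sumEFin; apply: eq_bigr => w _.
rewrite (eq_integral (cst (h w)%:E)); last by move=> x /set_mem[_ /= ->].
rewrite integral_cst// EFinM fineK ?fin_num_measure//.
by rewrite muleC.
Qed.

End csum.

(** * Borel measurability and the Bochner integral *)

Lemma borel_open (X : ptopologicalType) (U : set X) :
  open U -> measurable (U : set (borel X)).
Proof. by move=> oU; exact: sub_sigma_algebra. Qed.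

Lemma borel_closed (X : ptopologicalType) (U : set X) :
  closed U -> measurable (U : set (borel X)).
Proof. by move=> /closed_openC/borel_open/measurableC; rewrite setCK. Qed.

(** Stated for arbitrary generators because the topology of B * B and its base
    point are not bundled in a single structure. *)
Lemma measurable_fun_generated (X Y : pointedType) (G : set (set X))
    (H : set (set Y)) (f : X -> Y) : (forall U, H U -> G (f @^-1` U)) ->
  measurable_fun setT (f : g_sigma_algebraType G -> g_sigma_algebraType H).
Proof.
move=> HG; apply: (@measurability _ _ (g_sigma_algebraType G)
  (g_sigma_algebraType H) setT f H) => //.
by move=> _ [U HU <-]; rewrite setTI; apply: sub_sigma_algebra; exact: HG.
Qed.

Lemma continuous_borel_real (R : realType) (X : ptopologicalType) (f : X -> R) :
  continuous f -> measurable_fun setT (f : borel X -> R).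
Proof.
move=> /continuousP cf; apply: (measurability _ (RGenOpens.measurableE R)).
move=> _ [_ [a [b ->] <-]]; rewrite setTI; apply: borel_open; apply: cf.
exact: interval_open.
Qed.

Section bochner_theory.
Context (R : realType) (B : completeNormedModType R).
Context (d : measure_display) (T : measurableType d).
Implicit Types (mu : {finite_measure set T -> \bar R}) (f s : T -> B).

Lemma closed_finite_set (A : set B) : finite_set A -> closed A.
Proof.
apply: (accessible_finite_set_closed.1 _).
by apply: hausdorff_accessible; exact: norm_hausdorff.
Qed.

Lemma borel_finite_set (A : set B) :
  finite_set A -> measurable (A : set (borel B)).
Proof. by move=> fA; apply: borel_closed; exact: closed_finite_set. Qed.

Lemma borel_set1 (v : B) : measurable ([set v] : set (borel B)).
Proof. by apply: borel_finite_set; exact: finite_set1. Qed.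

Lemma simple_fun_finitary s : simple_fun s -> finitary s.
Proof.
move=> [ms fs]; split=> // w; rewrite -[X in measurable X]setTI.
by apply: ms => //; exact: borel_set1.
Qed.

Lemma finitary_simple_fun s : finitary s -> simple_fun s.
Proof.
move=> sP; split; last exact: sP.1.
by move=> _ Y _; rewrite setTI; exact: finitary_preimage.
Qed.

Lemma measurable_norm_sub f s : measurable_fun setT (f : T -> borel B) ->
  finitary s -> measurable_fun setT (fun x => `|f x - s x|).
Proof.
move=> mf sP.
apply: (@finitary_measurable_fun2 _ _ _ _ _ s (fun x w => `|f x - w|)) => // w.
apply: (measurableT_comp (f := (fun y : borel B => `|(y : B) - w|))) => //.
apply: continuous_borel_real => y.
by apply: cvg_norm; apply: cvgB; [exact: cvg_id|exact: cvg_cst].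
Qed.

(** On the fibres of (s, s') both sums become sums of the two projections. *)
Lemma csum_dist (nu : set T -> R) s s' : finadd nu -> finitary s -> finitary s' ->
  `|csum nu s id - csum nu s' id| <=
    csum nu (fun x => (s x, s' x)) (fun w => `|w.1 - w.2| : R^o).
Proof.
move=> nuP sP s'P; have pP := finitary_pair sP s'P.
rewrite -[X in csum _ X id - _]/(fst \o (fun x => (s x, s' x))).
rewrite -[X in _ - csum _ X id]/(snd \o (fun x => (s x, s' x))).
rewrite !csum_comp//= -(csumB _ _ _ pP).
exact: (le_trans (csum_norm _ nuP pP)).
Qed.

Lemma integral_dist_triangle mu D f s s' : measurable D ->
  measurable_fun setT (f : T -> borel B) -> finitary s -> finitary s' ->
  (\int[mu]_(x in D) (`|s x - s' x|)%:E <=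
   \int[mu]_(x in D) (`|f x - s x|)%:E + \int[mu]_(x in D) (`|f x - s' x|)%:E)%E.
Proof.
move=> mD mf sP s'P.
have m1 := measurable_funTS (D := D) (measurable_norm_sub mf sP).
have m2 := measurable_funTS (D := D) (measurable_norm_sub mf s'P).
have m3 : measurable_fun D (fun x => `|s x - s' x|).
  by apply/measurable_funTS/measurable_norm_sub => //; exact: (finitary_simple_fun sP).1.
rewrite -ge0_integralD//; [|exact/measurable_EFinP..].
apply: ge0_le_integral => //; [exact/measurable_EFinP|..].
  by apply: emeasurable_funD; exact/measurable_EFinP.
move=> x _; rewrite -EFinD lee_fin (distrC (f x)).
exact: ler_distD.
Qed.

Lemma simple_integral_dist mu D f s s' : measurable D ->
  measurable_fun setT (f : T -> borel B) -> finitary s -> finitary s' ->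
  ((`|simple_integral mu D s - simple_integral mu D s'|)%:E <=
   \int[mu]_(x in D) (`|f x - s x|)%:E + \int[mu]_(x in D) (`|f x - s' x|)%:E)%E.
Proof.
move=> mD mf sP s'P; apply: le_trans (integral_dist_triangle mu mD mf sP s'P).
rewrite (integral_finitary mu (fun w : B * B => `|w.1 - w.2| : R^o) mD (finitary_pair sP s'P)).
by rewrite lee_fin; apply: csum_dist => //; exact: finadd_measure.
Qed.

(** The integrals of two approximating sequences differ by at most the sum of
    their L^1 distances to f, which tends to zero. *)
Lemma bochner_unique mu D f v v' : measurable D ->
  measurable_fun setT (f : T -> borel B) ->
  is_bochner_integral mu D f v -> is_bochner_integral mu D f v' -> v = v'.
Proof.
move=> mD mf [_ [s [ss sf sv]]] [_ [s' [ss' sf' sv']]].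
apply/eqP; rewrite -subr_eq0 -normr_le0 -lee_fin.
apply: (lee_cvg_to (a := \oo)
  (f := fun k => (`|simple_integral mu D (s k) - simple_integral mu D (s' k)|)%:E)
  (g := fun k => (\int[mu]_(x in D) (`|f x - s k x|)%:E +
    \int[mu]_(x in D) (`|f x - s' k x|)%:E)%E)).
- apply: cvg_EFin; first by near=> k.
  by apply: cvg_norm; exact: cvgB.
- by rewrite -[X in _ --> X]adde0; exact: cvgeD.
- near=> k; apply: simple_integral_dist => //; exact: simple_fun_finitary.
Unshelve. all: by end_near. Qed.

Lemma bochner_integral_eq mu D f v : measurable D ->
  measurable_fun setT (f : T -> borel B) ->
  is_bochner_integral mu D f v -> bochner_integral mu D f = v.
Proof.
move=> mD mf fv; apply: (bochner_unique mD mf _ fv).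
by apply: xgetPex; exists v.
Qed.

Lemma scalar_csum (phi : {scalar B}) (nu : set T -> R) (W : choiceType)
    (t : T -> W) (g : W -> B) : finitary t ->
  phi (csum nu t g) = csum nu t (phi \o g : W -> R^o).
Proof.
move=> tP; rewrite /csum !fsbig_finite//; try exact: tP.1.
by rewrite linear_sum; apply: eq_bigr => w _; rewrite linearZ.
Qed.

Definition klip (L : R) (F : B -> R) := forall x y, `|F x - F y| <= L * `|x - y|.

Lemma scalar_klip (phi : {scalar B}) (L : R) :
  (forall x, `|phi x| <= L * `|x|) -> klip L phi.
Proof. by move=> phiL x y; rewrite -linearB. Qed.

Lemma klip_continuous (F : B -> R) (L : R) : klip L F -> continuous F.
Proof.
move=> FL x; apply/cvgrPdist_le => e e0.
have L0 : 0 < `|L| + 1 by rewrite ltr_pwDr.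
near=> y; rewrite (le_trans (FL _ _))//.
rewrite (@le_trans _ _ ((`|L| + 1) * `|x - y|))//.
  by rewrite ler_wpM2r// (le_trans (ler_norm _))// lerDl.
rewrite mulrC -ler_pdivlMr//; near: y; apply: cvgr_dist_le.
  exact: cvg_id.
by rewrite divr_gt0.
Unshelve. all: by end_near. Qed.

Lemma measurable_klip (F : B -> R) (L : R) f : klip L F ->
  measurable_fun setT (f : T -> borel B) -> measurable_fun setT (F \o f).
Proof.
move=> FL mf; apply: (measurableT_comp (f := (F : borel B -> R))) => //.
by apply: continuous_borel_real; exact: klip_continuous FL.
Qed.

Lemma measurable_normB f : measurable_fun setT (f : T -> borel B) ->
  measurable_fun setT (fun x => `|f x|).
Proof.
move=> mf; apply: (measurableT_comp (f := (fun y : borel B => `|y : B|))) => //.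
by apply: continuous_borel_real => y; exact: norm_continuous.
Qed.

Lemma integrable_klip (F : B -> R) (L : R) mu D f : measurable D ->
  klip L F -> measurable_fun setT (f : T -> borel B) ->
  (\int[mu]_(x in D) (`|f x|)%:E < +oo)%E ->
  mu.-integrable D (fun x => (F (f x))%:E).
Proof.
move=> mD FL mf fi.
apply: (@le_integrable _ _ _ _ _ _ _
    (fun x => (`|F 0|)%:E + L%:E * (`|f x|)%:E)%E) => //.
- exact/measurable_EFinP/measurable_funTS/measurable_klip.
- move=> x _; rewrite -EFinM -EFinD !abse_EFin lee_fin.
  rewrite (le_trans _ (ler_norm _))//.
  have := FL (f x) 0; rewrite subr0 -lerBlDl; apply: le_trans.
  exact: lerB_dist.
- apply: integrableD => //.
    exact: (finite_measure_integrable_cst mu `|F 0|).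
  apply: integrableZl => //; apply/integrableP; split.
    exact/measurable_EFinP/measurable_funTS/measurable_normB.
  by under eq_integral do rewrite abse_EFin normr_id.
Qed.

(** The equality holds for simple functions; both sides depend continuously on
    the function for the L^1 norm. *)
Lemma bochner_linear (phi : {scalar B}) (L : R) mu D f v : measurable D ->
  0 <= L ->
  (forall x, `|phi x| <= L * `|x|) ->
  measurable_fun setT (f : T -> borel B) ->
  (\int[mu]_(x in D) (`|f x|)%:E < +oo)%E ->
  is_bochner_integral mu D f v ->
  (\int[mu]_(x in D) (phi (f x))%:E = (phi v)%:E)%E.
Proof.
move=> mD L0 phiL mf fi [_ [s [ss sf sv]]].
have phi_int := integrable_klip mD (scalar_klip phiL) mf fi.
rewrite -(fineK (integrable_fin_num mD phi_int)); congr EFin.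
set J := fine _.
have phi_cvg : phi (simple_integral mu D (s k)) @[k --> \oo] --> phi v.
  have c : (phi : B -> R) x @[x --> v] --> (phi v : R) := klip_continuous (scalar_klip phiL) (x:=v).
  apply: cvg_comp; [exact: sv|exact: c].
apply/eqP; rewrite -subr_eq0 -normr_le0 -lee_fin.
apply: (lee_cvg_to (a := \oo)
  (f := fun k => (`|J - phi (simple_integral mu D (s k))|)%:E)
  (g := fun k => (L%:E * \int[mu]_(x in D) (`|f x - s k x|)%:E)%E)).
- apply: cvg_EFin; first by near=> k.
  by apply: cvg_norm; apply: cvgB => //; exact: cvg_cst.
- by rewrite -[X in _ --> X](mule0 L%:E); exact: cvgeZl.
- near=> k.
  have sP := simple_fun_finitary (ss k).
  have -> : phi (simple_integral mu D (s k)) =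
      fine (\int[mu]_(x in D) (phi (s k x))%:E).
    by rewrite (integral_finitary mu (phi : B -> R^o) mD sP)//= -scalar_csum.
  have phis_int : mu.-integrable D (fun x => (phi (s k x))%:E).
    apply/integrableP; split.
      exact/measurable_EFinP/measurable_funTS/finitary_measurable_fun.
    under eq_integral do rewrite abse_EFin.
    by rewrite (integral_finitary mu (fun w => `|phi w| : R^o) mD sP) ltry.
  have mfs := measurable_norm_sub mf sP.
  rewrite -ge0_integralZl_EFin//; last exact/measurable_EFinP/measurable_funTS.
  rewrite -fineB ?integrable_fin_num// -integralB_EFin// -abse_EFin.
  have dint := integrableB mD phi_int phis_int.
  rewrite fineK; last exact: integrable_fin_num dint.
  apply: (le_trans (le_abse_integral _ mD (measurable_int _ dint))).
  apply: ge0_le_integral => //.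
  + by apply: measurableT_comp => //; exact: measurable_int dint.
  + by apply: measurable_funeM; exact/measurable_EFinP/measurable_funTS.
  + by move=> x _; rewrite -EFinB abse_EFin -EFinM lee_fin -linearB.
Unshelve. all: by end_near. Qed.

End bochner_theory.

(** * Simple approximation and means of minorants of a measure *)

Section nearest.
Context (R : realType) (B : completeNormedModType R) (e : nat -> B).

(** A point among 0, e 0, ..., e (k - 1) nearest to x.  Starting from 0 keeps
    the error below the norm of x, the bound required by dominated convergence. *)
Fixpoint nearest (k : nat) (x : borel B) : B :=
  if k is k'.+1 then
    if `|(x : B) - e k'| < `|(x : B) - nearest k' x| then e k' else nearest k' x
  else 0.

Lemma nearest_finitary k : finitary (nearest k).
Proof.
elim: k => [|k ih] /=.
  split.
    by apply: sub_finite_set (finite_set1 (0 : B)) => _ [x _ <-].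
  move=> w; have [->|w0] := eqVneq w 0.
    rewrite (_ : _ @^-1` _ = setT)//.
    by apply/seteqP; split.
  rewrite (_ : _ @^-1` _ = set0)//.
  by apply/seteqP; split => // x /= /esym/eqP; rewrite (negbTE w0).
pose b (x : borel B) := `|(x : B) - e k| < `|(x : B) - nearest k x|.
have mb : measurable (b @^-1` [set true]).
  rewrite (_ : _ @^-1` _ = [set x | b x]); last by [].
  apply: (@finitary_bigcup _ _ _ (nearest k)
    (fun w => [set x : borel B | `|(x : B) - e k| < `|(x : B) - w|])) => // w.
  rewrite -[X in measurable X]setTI.
  apply: measurable_fun_ltr => //; apply: continuous_borel_real => x;
  by apply: cvg_norm; apply: cvgB; [exact: cvg_id|exact: cvg_cst].
have bP : finitary b.
  split; first by apply: sub_finite_set (@finite_finset _ setT).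
  case=> //; rewrite (_ : _ @^-1` _ = ~` (b @^-1` [set true])).
    exact: measurableC.
  by apply/seteqP; split => x /=; case: (b x).
exact: (finitary_comp (fun p : bool * B => if p.1 then e k else p.2)
  (finitary_pair bP ih)).
Qed.

Lemma nearest_le k (x : B) : `|x - nearest k x| <= `|x|.
Proof.
elim: k => [|k ih] /=; first by rewrite subr0.
by case: ifPn => // /ltW h; exact: le_trans ih.
Qed.

Lemma nearest_le_dist j k (x : B) : (j < k)%N -> `|x - nearest k x| <= `|x - e j|.
Proof.
elim: k => // k ih; rewrite ltnS leq_eqVlt /= => /orP[/eqP ->|jk].
  by case: ifPn => //; rewrite -leNgt.
by case: ifPn => [/ltW h|_]; [exact: (le_trans h (ih jk))|exact: ih].
Qed.

Hypothesis e_dense : forall (x : B) (r : R), 0 < r -> exists j, `|x - e j| < r.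

Lemma nearest_cvg (x : B) : `|x - nearest k x| @[k --> \oo] --> (0 : R).
Proof.
apply/cvgrPdist_le => r r0; have [j jr] := e_dense x r0.
near=> k; rewrite sub0r normrN normr_id; apply: le_trans (ltW jr).
by apply: nearest_le_dist; near: k; exact: nbhs_infty_gt.
Unshelve. all: by end_near. Qed.

End nearest.

Lemma separable_dense_seq (R : realType) (B : completeNormedModType R) :
  separable B -> exists e : nat -> B,
    forall (x : B) (r : R), 0 < r -> exists j, `|x - e j| < r.
Proof.
move=> [D cD dD].
have /pcard_surjP[e eD] := cD.
exists e => x r r0.
have [y [xy Dy]] : ball x r `&` D !=set0.
  by apply: dD; [exists x; exact: ballxx|exact: ball_open].
have [j _ ejy] := eD _ Dy.
by exists j; rewrite ejy; move: xy; rewrite -ball_normE.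
Qed.

Section mean.
Context (R : realType) (B : completeNormedModType R) (e : nat -> B).
Hypothesis e_dense : forall (x : B) (r : R), 0 < r -> exists j, `|x - e j| < r.
Context (d : measure_display) (T : measurableType d)
  (mu : {finite_measure set T -> \bar R}) (f : T -> B).
Hypothesis mf : measurable_fun setT (f : T -> borel B).
Hypothesis f_int : (\int[mu]_x (`|f x|)%:E < +oo)%E.

Let s k := nearest e k \o (f : T -> borel B).

Lemma approx_finitary k : finitary (s k).
Proof.
split.
  apply: sub_finite_set (nearest_finitary e k).1.
  by move=> _ [x _ <-]; exists (f x).
move=> w; rewrite /s comp_preimage -[X in measurable X]setTI; apply: mf => //.
exact: (nearest_finitary e k).2.
Qed.

Definition approx_error k : R := fine (\int[mu]_x (`|f x - s k x|)%:E).

Lemma approx_error_fin k :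
  (\int[mu]_x (`|f x - s k x|)%:E = (approx_error k)%:E)%E.
Proof.
rewrite fineK// ge0_fin_numE; last exact: integral_ge0.
apply: le_lt_trans f_int; apply: ge0_le_integral => //.
- exact/measurable_EFinP/measurable_norm_sub/approx_finitary.
- exact/measurable_EFinP/measurable_normB.
- by move=> x _; rewrite lee_fin; exact: nearest_le.
Qed.

Lemma approx_error_cvg : (approx_error k)%:E @[k --> \oo] --> 0%E.
Proof.
rewrite (_ : (fun k => _) = fun k => (\int[mu]_x (`|f x - s k x|)%:E)%E); last first.
  by apply/funext => k; rewrite approx_error_fin.
have -> : 0%E = (\int[mu]_x (cst 0%E) x)%E :> \bar R by rewrite integral0.
apply: (@dominated_cvg _ _ _ mu setT measurableT
  (fun k x => (`|f x - s k x|)%:E) _ (fun x => (`|f x|)%:E)) => //.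
- by move=> k; apply/measurable_EFinP/measurable_norm_sub/approx_finitary.
- by move=> x _; apply: cvg_EFin; [by near=> k|exact: nearest_cvg].
- apply/integrableP; split; first exact/measurable_EFinP/measurable_normB.
  by under eq_integral do rewrite abse_EFin normr_id.
- by move=> k x _; rewrite abse_EFin normr_id lee_fin; exact: nearest_le.
Unshelve. all: by end_near. Qed.

Lemma approx_error_cvgr : approx_error k @[k --> \oo] --> (0 : R).
Proof. exact: fine_cvg approx_error_cvg. Qed.

Lemma approx_error_ge0 k : 0 <= approx_error k.
Proof. by apply: fine_ge0; apply: integral_ge0. Qed.

(** Countable additivity of a minorant is automatic, see
    minorant_sigma_additive. *)
Definition minorant (nu : set T -> R) :=
  finadd nu /\ forall A, measurable A -> nu A <= fine (mu A).

(** The integral of f against nu.  The approximations of f are fixed once and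
    for all, so that the mean depends linearly on nu. *)
Definition mean (nu : set T -> R) : B := lim (csum nu (s k) id @[k --> \oo]).

(** The bound does not depend on nu, only on mu: this uniformity is what makes
    means continuous for setwise convergence. *)
Lemma minorant_csum_dist nu k l : minorant nu ->
  `|csum nu (s k) id - csum nu (s l) id| <= approx_error k + approx_error l.
Proof.
move=> [nuP numu].
have skP := approx_finitary k; have slP := approx_finitary l.
apply: (le_trans (csum_dist nuP skP slP)).
have h : forall A, measurable A -> nu A <= fine (mu (setT `&` A)).
  by move=> A mA; rewrite setTI numu.
apply: (le_trans (csum_le (finitary_pair skP slP) _ h)); first by move=> w.
rewrite -lee_fin EFinD -!approx_error_fin -integral_finitary//; last exact: finitary_pair.
exact: integral_dist_triangle.
Qed.

Lemma minorant_cvg nu : minorant nu -> csum nu (s k) id @[k --> \oo] --> mean nu.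
Proof.
move=> nuP; apply: cauchy_cvg; apply: cauchy_exP => r r0.
have r20 : 0 < r / 2 by rewrite divr_gt0.
have /cvgrPdist_lt /(_ _ r20) [N _ Nr] := approx_error_cvgr.
have Nlt k : (N <= k)%N -> approx_error k < r / 2.
  by move=> /Nr; rewrite /= sub0r normrN ger0_norm// approx_error_ge0.
exists (csum nu (s N) id); exists N => // k /= Nk.
rewrite -ball_normE/=.
apply: (le_lt_trans (minorant_csum_dist _ _ nuP)).
by rewrite [X in _ < X]splitr ltrD// Nlt.
Qed.

Lemma mean_dist nu k : minorant nu ->
  `|csum nu (s k) id - mean nu| <= approx_error k.
Proof.
move=> nuP; rewrite -[leRHS]addr0.
apply: (ler_cvg_to (a := \oo)
  (f := fun l => `|csum nu (s k) id - csum nu (s l) id|)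
  (g := fun l => approx_error k + approx_error l)).
- by apply: cvg_norm; apply: cvgB; [exact: cvg_cst|exact: minorant_cvg].
- by apply: cvgD; [exact: cvg_cst|exact: approx_error_cvgr].
- by near=> l; exact: minorant_csum_dist.
Unshelve. all: by end_near. Qed.

Lemma minorant_conv (a : R) nu nu' : 0 <= a <= 1 ->
  minorant nu -> minorant nu' ->
  minorant (fun A => a * nu A + (1 - a) * nu' A).
Proof.
move=> /andP[a0 a1] [[nu0 nuU] numu] [[nu'0 nu'U] nu'mu].
have a1' : 0 <= 1 - a by rewrite subr_ge0.
split; first split => [A mA|A C mA mC AC].
- by rewrite addr_ge0// mulr_ge0// ?nu0 ?nu'0.
- by rewrite nuU// nu'U//; lra.
- move=> A mA.
  have h1 := ler_wpM2l a0 (numu _ mA).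
  by have h2 := ler_wpM2l a1' (nu'mu _ mA); lra.
Qed.

Lemma mean_conv (a : R) nu nu' : 0 <= a <= 1 -> minorant nu -> minorant nu' ->
  mean (fun A => a * nu A + (1 - a) * nu' A) =
  a *: mean nu + (1 - a) *: mean nu'.
Proof.
move=> a01 nuP nu'P; apply: cvg_lim; first exact: norm_hausdorff.
have E k : csum (fun A => a * nu A + (1 - a) * nu' A) (s k) id =
    a *: csum nu (s k) id + (1 - a) *: csum nu' (s k) id.
  rewrite /csum !fsbig_finite//; try exact: (approx_finitary k).1.
  rewrite !scaler_sumr -big_split/=; apply: eq_bigr => w _.
  by rewrite !scalerA -scalerDl.
under eq_cvg do rewrite E.
by apply: cvgD; apply: cvgZr; exact: minorant_cvg.
Qed.

Lemma minorant_restr C : measurable C -> minorant (fun A => fine (mu (C `&` A))).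
Proof.
move=> mC; split; first exact: finadd_measure.
move=> A mA; apply: fine_le; rewrite ?fin_num_measure//; first exact: measurableI.
by apply: le_measure; rewrite ?inE//; exact: measurableI.
Qed.

(** Existence of the Bochner integral of an integrable map, with the value
    given by the fixed approximations. *)
Lemma bochner_mean C : measurable C ->
  is_bochner_integral mu C f (mean (fun A => fine (mu (C `&` A)))).
Proof.
move=> mC; split; first exact: measurable_funTS.
exists s; split.
- by move=> k; apply: finitary_simple_fun; exact: approx_finitary.
- apply: (@squeeze_cvge _ _ _ _ (cst 0%E) _ (fun k => (approx_error k)%:E)).
  + near=> k; rewrite integral_ge0//= -approx_error_fin.
    apply: ge0_subset_integral => //.
    exact/measurable_EFinP/measurable_norm_sub/approx_finitary.
  + exact: cvg_cst.
  + exact: approx_error_cvg.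
- by apply: minorant_cvg; exact: minorant_restr.
Unshelve. all: by end_near. Qed.

End mean.

(** * Separation of convex sets and Jensen's inequality *)

(** A subgradient at t of the distance to K, measured with the seminorm N, is
    the required functional: the distance vanishes on K, is at least eps at t,
    and grows at most like N.  Convexity of K makes the distance convex. *)
Lemma separation (R : realType) (E : lmodType R) (N : E -> R) (K : set E)
    (t : E) (eps : R) :
  (forall x y, N (x + y) <= N x + N y) ->
  (forall a x, N (a *: x) = `|a| * N x) ->
  (forall a x y, 0 <= a <= 1 -> K x -> K y -> K (a *: x + (1 - a) *: y)) ->
  K !=set0 -> (forall k, K k -> eps <= N (t - k)) ->
  exists g : {scalar E}, (forall x, `|g x| <= N x) /\
    forall k, K k -> eps <= g (t - k).
Proof.
move=> ND NZ Kcvx [k0 Kk0] Nt.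
have N0 : N 0 = 0 by rewrite -(scale0r (0 : E)) NZ normr0 mul0r.
have NN x : N (- x) = N x by rewrite -scaleN1r NZ normrN1 mul1r.
have Nge0 x : 0 <= N x by have := ND x (- x); rewrite subrr N0 NN; lra.
pose S z := [set N (z - k) | k in K].
pose q z := inf (S z).
have Sne z : S z !=set0 by exists (N (z - k0)), k0.
have Slb z : has_lbound (S z) by exists 0 => _ [k _ <-].
have q_le z k : K k -> q z <= N (z - k) by move=> Kk; apply: ge_inf => //; exists k.
have le_q z c : (forall k, K k -> c <= N (z - k)) -> c <= q z.
  by move=> h; apply: lb_le_inf => // _ [k Kk <-]; exact: h.
have qcvx : convex_real q.
  move=> a x y a01; have /andP[a0 a1] := a01.
  have a1' : 0 <= 1 - a by rewrite subr_ge0.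
  have h k k' : K k -> K k' ->
      q (a *: x + (1 - a) *: y) <= a * N (x - k) + (1 - a) * N (y - k').
    move=> Kk Kk'; apply: (le_trans (q_le _ _ (Kcvx _ _ _ a01 Kk Kk'))).
    rewrite opprD addrACA -!scalerBr (le_trans (ND _ _))//.
    by rewrite !NZ !ger0_norm.
  have h2 k' : K k' -> q (a *: x + (1 - a) *: y) <= a * q x + (1 - a) * N (y - k').
    move=> Kk'; have [a00|aN0] := eqVneq a 0.
      by have := h _ _ Kk0 Kk'; rewrite a00 !mul0r.
    have ap : 0 < a by rewrite lt_neqAle eq_sym aN0.
    rewrite -lerBlDr [a * q x]mulrC -ler_pdivrMr//; apply: le_q => k Kk.
    by rewrite ler_pdivrMr// lerBlDr [N _ * a]mulrC; exact: h.
  have [a00|aN0] := eqVneq (1 - a) 0.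
    by have := h2 _ Kk0; rewrite a00 !mul0r.
  have ap : 0 < 1 - a by rewrite lt_neqAle eq_sym aN0.
  rewrite -lerBlDl [_ * q y]mulrC -ler_pdivrMr//; apply: le_q => k Kk.
  by rewrite ler_pdivrMr// lerBlDl [N _ * (1 - a)]mulrC; exact: h2.
have [g gP] := subgradient t qcvx.
have gN x : g x <= N x.
  have := gP (t + x); rewrite addrAC subrr add0r.
  suff : q (t + x) <= q t + N x by lra.
  rewrite -lerBlDr; apply: le_q => k Kk; rewrite lerBlDr.
  by apply: (le_trans (q_le _ _ Kk)); rewrite addrAC; exact: ND.
exists g; split=> [x|k Kk].
  by rewrite ler_norml gN andbT lerNl -linearN -[leRHS]NN.
have := gP k.
have : q k <= 0 by rewrite -N0 -[in leRHS](subrr k); exact: q_le.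
have : eps <= q t by apply: le_q.
by rewrite !linearB; lra.
Qed.

Section jensen.
Context (R : realType) (B : completeNormedModType R).
Context (d : measure_display) (T : measurableType d).

(** Integrate the affine minorant of F that touches it at the mean of f. *)
Lemma jensen (mu : {finite_measure set T -> \bar R}) (C : set T) (f : T -> B)
    (v : B) (F : B -> R) (L : R) :
  measurable C -> measurable_fun setT (f : T -> borel B) ->
  (\int[mu]_(x in C) (`|f x|)%:E < +oo)%E ->
  is_bochner_integral mu C f v -> 0 <= L -> klip L F -> convex_real F ->
  0 < fine (mu C) ->
  (mu C * (F ((fine (mu C))^-1 *: v))%:E <= \int[mu]_(x in C) (F (f x))%:E)%E.
Proof.
move=> mC mf fi fv L0 FL Fcvx c0.
set c := fine _ in c0 *; set y0 := _ *: v.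
have [g gP] := subgradient y0 Fcvx.
have gL x : `|g x| <= L * `|x|.
  have h z : g z <= L * `|z|.
    have := gP (y0 + z); rewrite addrAC subrr add0r => h.
    have := le_trans (ler_norm _) (FL (y0 + z) y0).
    by rewrite addrAC subrr add0r; lra.
  by rewrite ler_norml h andbT lerNl -linearN -[in leRHS]normrN.
have gv := bochner_linear mC L0 gL mf fi fv.
have gi := integrable_klip mC (scalar_klip gL) mf fi.
have Fi := integrable_klip mC FL mf fi.
have ki : mu.-integrable C (fun=> (F y0 - g y0)%:E).
  exact: (finite_measure_integrable_cst mu (F y0 - g y0) mC).
apply: (@le_trans _ _ (\int[mu]_(x in C) ((F y0 - g y0)%:E + (g (f x))%:E))%E).
  rewrite integralD// gv integral_cst// -(@fineK _ (mu C)) ?fin_num_measure//.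
  rewrite -[X in (_ * X + _)%E]fineK ?fin_num_measure// -/c -!EFinM -EFinD lee_fin.
  have -> : g v = c * g y0 by rewrite -linearZ /y0 scalerA divff ?scale1r// gt_eqF.
  by lra.
apply: le_integral => //; first exact: integrableD.
by move=> x _; rewrite -EFinD lee_fin; have := gP (f x); rewrite linearB; lra.
Qed.

End jensen.

(** * Splittings of a measure and their compactness *)

Lemma ultra_fmap (T U : Type) (f : T -> U) (F : set_system T) :
  UltraFilter F -> UltraFilter (f @ F).
Proof.
move=> FU; have FF : ProperFilter F by exact: ultra_proper.
split; first exact: fmap_proper_filter.
move=> G GF FG; apply/seteqP; split=> [A GA|]; last exact: FG.
have [//|nA] := in_ultra_setVsetC (f @^-1` A) FU.
have GnA : G (~` A) by apply: FG.
have := filterI GA GnA; rewrite setICr => G0.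
by case: (@filter_not_empty _ G _ (G0 _)).
Qed.

(** Limits along an ultrafilter exist without passing to subsequences, hence
    simultaneously for all measurable sets. *)
Lemma ultra_bounded_cvg (R : realType) (U : set_system nat) (u : nat -> R) M :
  UltraFilter U -> (forall k, 0 <= u k <= M) -> cvg (u k @[k --> U]).
Proof.
move=> UU uM; have := @segment_compact R 0 M; rewrite compact_ultra => cM.
have [||l [_ ul]] := cM (u @ U); first exact: ultra_fmap.
  have UF : ProperFilter U by exact: ultra_proper.
  rewrite /fmap/=; have -> : u @^-1` `[0, M]%classic = setT; last exact: filterT.
  by apply/seteqP; split => // k _ /=; rewrite in_itv/= uM.
by apply/cvg_ex; exists l.
Qed.

Lemma cvg_bigsum (R : numFieldType) (V : normedModType R) (S : Type)
    (F : set_system S) (J : Type) (r : seq J) (u : S -> J -> V) (l : J -> V) :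
  Filter F -> (forall j, u k j @[k --> F] --> l j) ->
  \sum_(j <- r) u k j @[k --> F] --> \sum_(j <- r) l j.
Proof.
move=> FF ul; elim: r => [|j r ih].
  by under eq_cvg do rewrite big_nil; rewrite big_nil; exact: cvg_cst.
under eq_cvg do rewrite big_cons.
by rewrite big_cons; apply: cvgD; [exact: ul|exact: ih].
Qed.

Section splittings.
Context (R : realType) (B : completeNormedModType R) (e : nat -> B).
Hypothesis e_dense : forall (x : B) (r : R), 0 < r -> exists j, `|x - e j| < r.
Context (d : measure_display) (T : measurableType d)
  (mu : {finite_measure set T -> \bar R}) (f : T -> B).
Hypothesis mf : measurable_fun setT (f : T -> borel B).
Hypothesis f_int : (\int[mu]_x (`|f x|)%:E < +oo)%E.
Context (I : finType).

Let s k := nearest e k \o (f : T -> borel B).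

Local Notation mean := (mean e f).

(** A decomposition of mu into pieces indexed by I; each piece plays the part
    of the unnormalised conditional law of y given the atom i. *)
Definition splitting (nu : I -> set T -> R) :=
  (forall i, finadd (nu i)) /\
  (forall A, measurable A -> \sum_i nu i A = fine (mu A)).

Lemma splitting_minorant nu i : splitting nu -> minorant mu (nu i).
Proof.
move=> [nuP nuE]; split=> // A mA; rewrite -nuE// (bigD1 i)//= lerDl.
by apply: sumr_ge0 => j _; exact: (nuP j).1.
Qed.

Lemma splitting_conv (a : R) nu nu' : 0 <= a <= 1 -> splitting nu -> splitting nu' ->
  splitting (fun i A => a * nu i A + (1 - a) * nu' i A).
Proof.
move=> a01 nuP nu'P; split=> [i|A mA].
  by apply: (minorant_conv a01 _ _).1; exact: splitting_minorant.
by rewrite big_split/= -!mulr_sumr nuP.2// nu'P.2//; lra.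
Qed.

(** Masses and means attained approximately by splittings are attained: take
    the setwise limit of approximate solutions along an ultrafilter.  Means
    pass to the limit because simple approximations of f reduce them, up to an
    error uniform in the splitting, to finite combinations of values on sets. *)
Lemma splitting_closed (p : I -> R) (w : I -> B) :
  (forall eps, 0 < eps -> exists nu, splitting nu /\
    forall i, `|nu i setT - p i| <= eps /\ `|mean (nu i) - w i| <= eps) ->
  exists nu, splitting nu /\ forall i, nu i setT = p i /\ mean (nu i) = w i.
Proof.
move=> h.
have /choice[nu nuP] : forall k : nat, exists nu, splitting nu /\
    forall i, `|nu i setT - p i| <= k.+1%:R^-1 /\
              `|mean (nu i) - w i| <= k.+1%:R^-1.
  by move=> k; apply: h; rewrite invr_gt0.
(* a free ultrafilter: it contains every final segment of nat *)
have [U [UU oU]] := ultraFilterLemma (@eventually_filter).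
have UF : ProperFilter U by exact: ultra_proper.
have nuU i A : measurable A -> cvg (nu k i A @[k --> U]).
  move=> mA; apply: (ultra_bounded_cvg (M := fine (mu A))) => // k.
  have [m0 m1] := splitting_minorant i (nuP k).1.
  by rewrite m1// andbT m0.1.
pose nu' i A := lim (nu k i A @[k --> U]).
have nu'P : splitting nu'.
  split=> [i|A mA].
    split=> [A mA|A C mA mC AC].
      apply: limr_ge; first exact: nuU.
      by near=> k; exact: ((nuP k).1.1 i).1.
    apply: cvg_lim => //.
    rewrite (_ : (fun k => _) = fun k => nu k i A + nu k i C); last first.
      by apply/funext => k; exact: ((nuP k).1.1 i).2.
    by apply: cvgD; exact: nuU.
  have h1 : \sum_i nu k i A @[k --> U] --> \sum_i nu' i A.
    by apply: cvg_bigsum => i; exact: nuU.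
  have h2 : \sum_i nu k i A @[k --> U] --> fine (mu A).
    rewrite (_ : (fun k => _) = fun=> fine (mu A)); first exact: cvg_cst.
    by apply/funext => k; exact: (nuP k).1.2.
  exact: (cvg_unique _ h1 h2).
have inv_cvg : (k.+1%:R^-1 : R) @[k --> U] --> (0 : R).
  by move=> Y /(@cvg_harmonic R) Y0; exact: oU.
exists nu'; split=> // i; split.
- apply: cvg_lim => //; apply/cvgrPdist_le => r r0.
  have /cvgrPdist_le /(_ _ r0) := inv_cvg.
  apply: filterS => k; rewrite sub0r normrN ger0_norm ?invr_ge0// => kr.
  by rewrite distrC (le_trans _ kr)//; exact: ((nuP k).2 i).1.
- have key m : `|mean (nu' i) - w i| <= approx_error e mu f m + approx_error e mu f m.
    rewrite (le_trans (ler_distD (csum (nu' i) (s m) id) _ _))//.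
    rewrite distrC lerD//; first exact: (mean_dist e_dense mf f_int m (splitting_minorant i nu'P)).
    apply: (ler_cvg_to (a := U)
      (f := fun k => `|csum (nu k i) (s m) id - mean (nu k i)|)
      (g := fun=> approx_error e mu f m)).
    + apply: cvg_norm; apply: cvgB.
        have sm1 := (approx_finitary e mf m).1.
        rewrite /csum fsbig_finite//.
        rewrite (_ : (fun k => _) = fun k =>
            \sum_(x <- fset_set (range (s m))) nu k i (s m @^-1` [set x]) *: id x); last first.
          by apply/funext => k; rewrite fsbig_finite.
        apply: cvg_bigsum => x; apply: cvgZl; apply: nuU.
        exact: (approx_finitary e mf m).2.
      apply/cvgrPdist_le => r r0.
      have /cvgrPdist_le /(_ _ r0) := inv_cvg.
      apply: filterS => k; rewrite sub0r normrN ger0_norm ?invr_ge0// => kr.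
      by rewrite distrC (le_trans _ kr)//; exact: ((nuP k).2 i).2.
    + exact: cvg_cst.
    + by near=> k; apply: (mean_dist e_dense mf f_int m); exact: splitting_minorant (nuP k).1.
  apply/eqP; rewrite -subr_eq0 -normr_le0.
  apply: (ler_cvg_to (a := \oo) (f := fun=> `|mean (nu' i) - w i|)
    (g := fun m => approx_error e mu f m + approx_error e mu f m)).
  + exact: cvg_cst.
  + by rewrite -[X in _ --> X](addr0 0); apply: cvgD; exact: approx_error_cvgr.
  + by near=> m.
Unshelve. all: by end_near. Qed.

End splittings.

(** * Strassen's theorem for finitely many atoms *)

Section strassen.
Context (R : realType) (B : completeNormedModType R) (e : nat -> B).
Hypothesis e_dense : forall (x : B) (r : R), 0 < r -> exists j, `|x - e j| < r.
Context (d : measure_display) (T : measurableType d)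
  (mu : {finite_measure set T -> \bar R}) (f : T -> B).
Hypothesis mf : measurable_fun setT (f : T -> borel B).
Hypothesis f_int : (\int[mu]_x (`|f x|)%:E < +oo)%E.
Context (I : finType).

Local Notation mean := (mean e f).

Lemma integral_finType_partition (S : T -> I) (h : T -> R) :
  (forall i, measurable (S @^-1` [set i])) -> measurable_fun setT h ->
  (\int[mu]_x (h x)%:E = \sum_i \int[mu]_(x in S @^-1` [set i]) (h x)%:E)%E.
Proof.
move=> mS mh.
have E : \big[setU/set0]_i (S @^-1` [set i]) = setT.
  apply/seteqP; split => // x _; rewrite -bigcup_seq.
  by exists (S x); rewrite //= mem_index_enum.
rewrite -[in LHS]E integral_bigsetU_EFin ?index_enum_uniq ?E//.
- by move=> a b _ _ [x [<- <-]].
- exact/measurable_EFinP.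
Qed.

Lemma splitting_restr (S : T -> I) : (forall i, measurable (S @^-1` [set i])) ->
  splitting mu (fun i A => fine (mu (S @^-1` [set i] `&` A))).
Proof.
move=> mS; split=> [i|A mA]; first exact: finadd_measure.
have SP : finitary S.
  by split => //; apply: sub_finite_set (@finite_finset _ setT).
have /(congr1 fine) /= := integral_finType_partition mS
  (measurable_indic (D := setT) mA : measurable_fun setT (\1_A : T -> R)).
rewrite integral_indic// setIT => ->.
rewrite -sum_fine => [|i _]; last first.
  by rewrite integral_indic// fin_num_measure//; exact: measurableI.
by apply: eq_bigr => i _; rewrite integral_indic// setIC.
Qed.

(** Ties are broken by the enumeration of I, which makes the selection
    measurable. *)
Lemma measurable_argmax (l : I -> B -> R) (i0 : I) :
  (forall i, continuous (l i)) ->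
  exists S : B -> I, (forall j y, l j y <= l (S y) y) /\
    forall i, measurable (S @^-1` [set i] : set (borel B)).
Proof.
move=> lc.
pose A i := [set y : borel B | forall j, l j y <= l i y /\
  ((enum_rank j < enum_rank i)%N -> l j y < l i y)].
have mA i : measurable (A i).
  rewrite (_ : A i = \bigcap_(j in [set: I])
    ([set y | l j y <= l i y] `&`
     (if (enum_rank j < enum_rank i)%N then [set y | l j y < l i y] else setT))).
    apply: fin_bigcap_measurable => // j _.
    have ml k : measurable_fun setT (l k : borel B -> R).
      exact: continuous_borel_real.
    apply: measurableI.
      rewrite -[X in measurable X]setTI.
      by apply: measurable_fun_ler.
    case: ifP => // _; rewrite -[X in measurable X]setTI.
    by apply: measurable_fun_ltr.
  apply/seteqP; split => y /=.
    by move=> Ay j _; split; [exact: (Ay j).1|case: ifP => // /(Ay j).2].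
  move=> Ay j; have [h1 h2] := Ay j Logic.I.
  by split=> // ji; move: h2; rewrite ji.
have Aex y : exists i, A i y.
  have [i1 _ i1max] : { i1 | true & forall j, l j y <= l i1 y }.
    have := @arg_maxP _ _ _ i0 xpredT (l ^~ y) isT.
    by case=> i1 _ h; exists i1 => // j; exact: h.
  pose P i := [forall j, l j y <= l i y].
  have P1 : P i1 by apply/forallP.
  have [i /forallP Pi imin] := arg_minnP (fun i => enum_rank i : nat) P1.
  exists i => j; split=> // ji; rewrite lt_neqAle Pi andbT.
  apply/eqP => lij; move: ji; rewrite ltnNge imin//.
  by apply/forallP => k; rewrite lij Pi.
have /choice[S SP] := Aex; exists S; split=> [j y|i].
  exact: (SP y j).1.
rewrite (_ : S @^-1` [set i] = A i)//; apply/seteqP; split => [y /= <-//|y Ay].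
apply/eqP/negPn/negP => Si.
have [h|h] := ltnP (enum_rank (S y)) (enum_rank i).
  by have := (Ay (S y)).2 h; rewrite ltNge (SP y i).1.
have {}h : (enum_rank i < enum_rank (S y))%N.
  rewrite ltn_neqAle h andbT; apply: contra Si => /eqP h'.
  by apply/eqP/esym/enum_rank_inj/val_inj.
by have := (SP y i).2 h; rewrite ltNge (Ay (S y)).1.
Qed.

Local Notation E := (I -> R^o * B)%type.

(** Otherwise the family t of the (p i, p i v i) is separated from the convex
    set K of the (mass, mean) families of splittings by a functional g.  Its
    components are affine functions l i on B; F denotes their maximum and k the
    family of the splitting of mu by the index that attains it.  Then g k is
    the integral of F, while g t, the sum of the p i * l i (v i), is at most
    the sum of the p i * F (v i), hence by assumption at most the integral of F.
    This contradicts g k < g t. *)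
Lemma strassen (i0 : I) (p : I -> R) (v : I -> B) : (forall i, 0 <= p i) ->
  (forall (F : B -> R) (L : R), 0 <= L -> klip L F -> convex_real F ->
    ((\sum_i p i * F (v i))%:E <= \int[mu]_x (F (f x))%:E)%E) ->
  exists nu, splitting mu nu /\
    forall i, nu i setT = p i /\ mean (nu i) = p i *: v i.
Proof.
move=> p0 hF; apply: (splitting_closed e_dense mf f_int); apply: contrapT.
move=> /existsNP[eps /not_implyP[eps0 /forallNP far]].
pose N (z : E) : R := \sum_i (`|(z i).1| + `|(z i).2|).
pose K := [set z : E | exists2 nu, splitting mu nu &
  z = fun i => (nu i setT, mean (nu i))].
pose t : E := fun i => (p i, p i *: v i).
have ND x y : N (x + y) <= N x + N y.
  rewrite /N -big_split/=; apply: ler_sum => i _.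
  by rewrite addrACA lerD// ler_normD.
have NZ a x : N (a *: x) = `|a| * N x.
  rewrite /N mulr_sumr; apply: eq_bigr => i _.
  by rewrite /= !normrZ mulrDr.
have Kcvx a x y : 0 <= a <= 1 -> K x -> K y -> K (a *: x + (1 - a) *: y).
  move=> a01 [nu nuP ->] [nu' nu'P ->].
  exists (fun i A => a * nu i A + (1 - a) * nu' i A); first exact: splitting_conv.
  apply/funext => i.
  have nui := splitting_minorant i nuP; have nu'i := splitting_minorant i nu'P.
  by rewrite (mean_conv e_dense mf f_int a01 nui nu'i).
have K0 : K !=set0.
  pose nu i A := fine (mu ((fun=> i0) @^-1` [set i] `&` A)).
  exists (fun i => (nu i setT, mean (nu i))); exists nu => //.
  apply: splitting_restr => i.
  have [->|ii0] := eqVneq i i0.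
    by rewrite (_ : _ @^-1` _ = setT)//; apply/seteqP; split.
  rewrite (_ : _ @^-1` _ = set0)//; apply/seteqP; split => // x /= i0i.
  by rewrite i0i eqxx in ii0.
have Nt k : K k -> eps <= N (t - k).
  move=> [nu nuP ->]; have /not_andP[//|/existsNP[i /not_andP]] := far nu.
  have Ni : `|nu i setT - p i| + `|mean (nu i) - p i *: v i| <=
      N (t - fun i => (nu i setT, mean (nu i))).
    rewrite /N (bigD1 i)//= distrC [X in _ + X <= _]distrC lerDl.
    by apply: sumr_ge0 => j _; rewrite addr_ge0.
  move=> h; apply: le_trans Ni; move: h => -[/negP|/negP]; rewrite -ltNge => /ltW h.
    by rewrite (le_trans h)// lerDl.
  by rewrite (le_trans h)// lerDr.
have [g [gN gK]] := separation ND NZ Kcvx K0 Nt.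
pose delta i (w : R^o * B) : E := fun j => if j == i then w else 0.
have deltaP i a w w' : delta i (a *: w + w') = a *: delta i w + delta i w'.
  apply/funext => j; rewrite /delta/=.
  rewrite [RHS]/(a *: (if j == i then w else 0) + (if j == i then w' else 0)).
  by case: ifP => // _; rewrite scaler0; apply/esym; exact: addr0.
have Ndelta i w : N (delta i w) = `|w.1| + `|w.2|.
  rewrite /N (bigD1 i)//= /delta eqxx big1 ?addr0// => j /negbTE ->.
  by rewrite /= !normr0 addr0.
pose alpha i := g (delta i (1, 0)).
have philin i : scalar (fun y => g (delta i (0, y))).
  move=> a x y; rewrite -linearP -deltaP; congr (g (delta i _)).
  by congr pair; rewrite -[RHS]/(a * 0 + 0) mulr0 addr0.
pose phi i : {scalar B} := HB.pack (fun y => g (delta i (0, y)))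
  (GRing.isLinear.Build R B R *%R _ (philin i)).
have phi1 i x : `|phi i x| <= 1 * `|x|.
  by rewrite mul1r (le_trans (gN _))// Ndelta normr0 add0r.
have gE (z : E) : g z = \sum_i (alpha i * (z i).1 + phi i (z i).2).
  have zE : z = \sum_i delta i (z i).
    apply/funext => j; rewrite fct_sumE (bigD1 j)//= /delta eqxx big1 ?addr0// => i.
    by rewrite eq_sym => /negbTE ->.
  rewrite {1}zE linear_sum; apply: eq_bigr => i _.
  rewrite [alpha i * _]mulrC -linearP; congr (g _); rewrite -deltaP.
  congr (delta i _); rewrite [LHS]surjective_pairing; congr pair.
    by rewrite -[RHS]/((z i).1 * 1 + 0) mulr1 addr0.
  by rewrite -[RHS]/((z i).1 *: 0 + (z i).2) scaler0 add0r.
pose l i y := alpha i + phi i y.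
have lB i x y : l i x - l i y <= `|x - y|.
  rewrite /l opprD addrACA subrr add0r -linearB.
  by rewrite (le_trans (ler_norm _))// (le_trans (phi1 _ _))// mul1r.
have lc i : continuous (l i).
  apply: (klip_continuous (L := 1)) => x y.
  rewrite mul1r ler_norml lB andbT lerNl opprB distrC.
  exact: lB.
have [S [Smax mS]] := measurable_argmax i0 lc.
pose F y := l (S y) y.
have FB x y : F x - F y <= `|x - y|.
  by rewrite (le_trans _ (lB (S x) x y))// lerD2l lerN2 Smax.
have FL : klip 1 F.
  move=> x y; rewrite mul1r ler_norml FB andbT lerNl opprB distrC.
  exact: FB.
have Fcvx : convex_real F.
  move=> a x y /andP[a0 a1]; rewrite [in leLHS]/F /l; set i := S _.
  rewrite linearD !linearZ.
  have h1 := ler_wpM2l a0 (Smax i x).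
  have a1' : 0 <= 1 - a by rewrite subr_ge0.
  have h2 := ler_wpM2l a1' (Smax i y).
  by rewrite /l in h1 h2; rewrite /F /l /=; lra.
have := hF F 1 ler01 FL Fcvx.
have mSf i : measurable ((S \o f) @^-1` [set i]).
  rewrite comp_preimage -[X in measurable X]setTI.
  exact: mf.
pose nu i A := fine (mu ((S \o f) @^-1` [set i] `&` A)).
have nuP : splitting mu nu by exact: splitting_restr.
pose k : E := fun i => (nu i setT, mean (nu i)).
have -> : (\int[mu]_x (F (f x))%:E = (g k)%:E)%E.
  rewrite (integral_finType_partition mSf (measurable_klip FL mf)) gE -sumEFin.
  apply: eq_bigr => i _.
  rewrite (eq_integral (fun x => ((alpha i)%:E + (phi i (f x))%:E)%E)); last first.
    by move=> x; rewrite inE /= => <-.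
  have mD := mSf i; set D := _ @^-1` _ in mD *.
  have fiD : (\int[mu]_(x in D) (`|f x|)%:E < +oo)%E.
    apply: le_lt_trans f_int; apply: ge0_subset_integral => //.
    exact/measurable_EFinP/measurable_normB.
  rewrite integralD//; last 2 first.
  - exact: (finite_measure_integrable_cst mu (alpha i) mD).
  - exact: (integrable_klip mD (scalar_klip (phi1 i)) mf fiD).
  rewrite (bochner_linear mD ler01 (phi1 i) mf fiD
    (bochner_mean e_dense mf f_int mD)).
  rewrite integral_cst// EFinD EFinM /k/= /nu setIT fineK//.
  exact: fin_num_measure.
rewrite lee_fin => h.
have := gK k; have Kk : K k by exists nu.
move=> /(_ Kk); rewrite linearB.
suff : g t <= \sum_i p i * F (v i) by lra.
rewrite gE; apply: ler_sum => i _.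
have -> : phi i (t i).2 = p i * phi i (v i) by rewrite -[LHS]/(phi i (p i *: v i)) linearZ.
rewrite [alpha i * _]mulrC -mulrDr; apply: ler_wpM2l; [exact: p0|exact: Smax].
Qed.

End strassen.

(** * Couplings built from splittings *)

Section minorant_measure.
Context (d : measure_display) (T : measurableType d) (R : realType).
Context (mu : {finite_measure set T -> \bar R}).

(** Applied both to a minorant and to the measure above it, this transfers the
    convergence of the series from the latter to the former. *)
Lemma finadd_tail (nu : set T -> R) (F : nat -> set T) n : finadd nu ->
  (forall k, measurable (F k)) -> trivIset setT F ->
  nu (\bigcup_k F k) - \sum_(0 <= k < n) nu (F k) =
  nu (\bigcup_k F k `\` \big[setU/set0]_(0 <= k < n) F k).
Proof.
move=> nuP mF tF; rewrite -finadd_bigsetU ?iota_uniq//; last exact: sub_trivIset tF.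
set U := \big[setU/set0]_(_ <- _) _; set A := \bigcup_k _.
have mA : measurable A by exact: bigcupT_measurable.
have mU : measurable U by exact: bigsetU_measurable.
have UA : U `<=` A.
  by move=> x; rewrite /U -bigcup_seq => -[k _ Fk]; exists k.
rewrite -[in X in X - _](setDUK UA) nuP.2 ?setDIK//; last exact: measurableD.
by rewrite addrAC subrr add0r.
Qed.

Lemma minorant_sigma_additive (nu : set T -> R) (F : nat -> set T) :
  minorant mu nu -> (forall k, measurable (F k)) -> trivIset setT F ->
  \sum_(0 <= k < n) nu (F k) @[n --> \oo] --> nu (\bigcup_k F k).
Proof.
move=> [nuP numu] mF tF.
have muP : finadd (fun A => fine (mu A)).
  suff -> : (fun A => fine (mu A)) = (fun A => fine (mu (setT `&` A))).
    exact: finadd_measure.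
  by apply/funext => A; rewrite setTI.
have mA : measurable (\bigcup_k F k) by exact: bigcupT_measurable.
have mU n : measurable (\big[setU/set0]_(0 <= k < n) F k) by exact: bigsetU_measurable.
have mucvg : \sum_(0 <= k < n) fine (mu (F k)) @[n --> \oo] -->
    fine (mu (\bigcup_k F k)).
  rewrite (_ : (fun n => _) = fine \o (fun n => \sum_(0 <= k < n) mu (F k))%E).
    apply: fine_cvg; rewrite fineK ?fin_num_measure//.
    exact: measure_sigma_additive.
  by apply/funext => n /=; rewrite -sum_fine// => k _; exact: fin_num_measure.
apply/cvgrPdist_le => r r0.
have /cvgrPdist_le /(_ _ r0) := mucvg.
apply: filterS => n; rewrite !finadd_tail// => h.
rewrite ger0_norm; last by apply: nuP.1; exact: measurableD.
rewrite (le_trans (numu _ _))//; first exact: measurableD.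
by rewrite -(finadd_tail n muP mF tF); exact: le_trans (ler_norm _) h.
Qed.

End minorant_measure.

(** Normalisation turns a measure into a bundled probability; it changes
    nothing when the total mass is already 1. *)
Lemma measure_probability d (T : measurableType d) (R : realType)
    (m : set T -> \bar R) : m set0 = 0%E -> (forall A, 0 <= m A)%E ->
  semi_sigma_additive m -> m setT = 1%E ->
  exists P : probability T R, forall A, P A = m A.
Proof.
move=> m0 m_ge0 msigma mT.
have [m' m'E] : exists m' : {measure set T -> \bar R}, (m' : set T -> \bar R) = m.
  pose m' : {measure set T -> \bar R} :=
    HB.pack m (isMeasure.Build _ _ R m m0 m_ge0 msigma).
  by exists m'.
exists (mnormalize m' point) => A.
by rewrite -[LHS]/(mnormalize m' point A) /mnormalize m'E mT onee_eq0/= invr1 mule1.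
Qed.

Section coupling.
Context (R : realType) (B : completeNormedModType R).
Context (gamma : probability (borel B) R) (I : finType).

Lemma measurable_pair_section (x : B) :
  measurable_fun setT ((fun y => (x, y)) : borel B -> borel (B * B)).
Proof.
apply: measurable_fun_generated; apply/continuousP => y.
by apply: cvg_pair; [exact: cvg_cst|exact: cvg_id].
Qed.

Lemma measurable_section (x : B) (C : set (borel (B * B))) :
  measurable C -> measurable ((fun y : B => (x, y)) @^-1` C : set (borel B)).
Proof.
move=> mC; rewrite -[X in measurable X]setTI.
exact: (measurable_pair_section x measurableT mC).
Qed.

Lemma measurable_borel_snd :
  measurable_fun setT (snd : borel (B * B) -> borel B).
Proof.
apply: measurable_fun_generated; apply/continuousP => -[x y].
exact: cvg_snd.
Qed.

Lemma measurable_borel_fst :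
  measurable_fun setT (fst : borel (B * B) -> borel B).
Proof.
apply: measurable_fun_generated; apply/continuousP => -[x y].
exact: cvg_fst.
Qed.

(** The sum over i of the products of the Dirac mass at v i with nu i. *)
Lemma coupling (v : I -> B) (nu : I -> set (borel B) -> R) : splitting gamma nu ->
  exists pi : probability (borel (B * B)) R, forall C, measurable C ->
    pi C = (\sum_i nu i ((fun y : B => (v i, y)) @^-1` C))%:E.
Proof.
move=> nuP.
(* a measure must be nonnegative on every set, also where nu i is arbitrary *)
pose m (C : set (borel (B * B))) : \bar R :=
  (\sum_i `|nu i ((fun y : B => (v i, y)) @^-1` C)|)%:E.
have mE C : measurable C -> m C = (\sum_i nu i ((fun y : B => (v i, y)) @^-1` C))%:E.
  move=> mC; congr EFin; apply: eq_bigr => i _; rewrite ger0_norm//.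
  by apply: (nuP.1 i).1; exact: measurable_section.
have m0 : m set0 = 0%E.
  rewrite mE// big1// => i _; rewrite preimage_set0.
  exact: finadd0 (nuP.1 i).
have m_ge0 C : (0 <= m C)%E by rewrite lee_fin sumr_ge0.
have msigma : semi_sigma_additive m.
  move=> F mF tF mUF; rewrite mE//.
  rewrite (_ : (fun n => _) = fun n => (\sum_i \sum_(0 <= k < n)
      nu i ((fun y : B => (v i, y)) @^-1` F k))%:E); last first.
    apply/funext => n; rewrite exchange_big/= -sumEFin.
    by apply: eq_bigr => k _; rewrite mE.
  apply: cvg_EFin; first by near=> n.
  apply: cvg_bigsum => i; rewrite preimage_bigcup.
  apply: (minorant_sigma_additive (splitting_minorant i nuP)).
    by move=> k; exact: measurable_section.
  by move=> a b _ _ [y [Fa Fb]]; apply: tF => //; exists (v i, y).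
have mT : m setT = 1%E.
  rewrite mE//; under eq_bigr do rewrite preimage_setT.
  rewrite nuP.2//; congr EFin.
  exact: (congr1 fine (probability_setT gamma)).
have [pi piE] := measure_probability m0 m_ge0 msigma mT.
by exists pi => C mC; rewrite piE mE.
Unshelve. all: by end_near. Qed.

End coupling.

(** * Atomic measures and supports *)

Section atomic.
Context (R : realType) (B : completeNormedModType R).

Lemma finite_range (J : finType) (X : Type) (y : J -> X) : finite_set (range y).
Proof. exact: finite_image. Qed.

(** Every fibre is contained in a point, or is the complement of the range of
    y. *)
Lemma finitary_pick (J : finType) (y : J -> B) :
  finitary (fun x : borel B => [pick j | y j == x]).
Proof.
split; first by apply: sub_finite_set (@finite_finset _ setT).
case=> [j|].
  apply: borel_finite_set; apply: sub_finite_set (finite_set1 (y j)) => x /=.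
  by case: pickP => // i /eqP <- [->].
rewrite (_ : _ @^-1` _ = ~` range y).
  by apply: measurableC; apply: borel_finite_set; exact: finite_range.
apply/seteqP; split => x /=; case: pickP => [j /eqP yj|jx] //.
  by move=> _ [j _ yjx]; have := jx j; rewrite yjx eqxx.
by case; exists j.
Qed.

(** The points y j may coincide.  Off their finite set zeta vanishes, and on it
    F factors through a choice of index, which is a finitary map. *)
Lemma integral_atomic (J : finType) (c : J -> R) (y : J -> B)
    (zeta : {finite_measure set (borel B) -> \bar R}) (F : B -> R) :
  (forall A : set (borel B), measurable A ->
    zeta A = (\sum_j c j * \1_A (y j))%:E) ->
  measurable_fun setT (F : borel B -> R) ->
  (\int[zeta]_x (F x)%:E = (\sum_j c j * F (y j))%:E)%E.
Proof.
move=> zE mF.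
pose t (x : borel B) : option J := [pick j | y j == x].
have tP : finitary t := finitary_pick y.
pose h (w : option J) : R^o := if w is Some j then F (y j) else 0.
have ht j : h (t (y j)) = F (y j).
  by rewrite /t; case: pickP => [i /eqP <-//|/(_ j)]; rewrite eqxx.
have mY : measurable (~` range y : set (borel B)).
  by apply: measurableC; apply: borel_finite_set; exact: finite_range.
transitivity (\int[zeta]_x (h (t x))%:E)%E.
  apply: ae_eq_integral => //.
  - exact/measurable_EFinP.
  - exact/measurable_EFinP/finitary_measurable_fun.
  exists (~` range y); split => //.
    apply: (etrans (zE _ mY)); rewrite big1// => j _.
    by rewrite indicE memNset ?mulr0//; apply; exists j.
  move=> x /= nx; apply: contra_not nx => -[j _ <-] _.
  by rewrite ht.
rewrite (integral_finitary zeta h measurableT tP) /csum fsbig_finite//; last exact: tP.1.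
congr EFin.
have E w : fine (zeta (setT `&` t @^-1` [set w])) = \sum_j (c j * (t (y j) == w)%:R).
  rewrite setTI zE; last exact: tP.2.
  apply: eq_bigr => j _; rewrite indicE; congr (_ * _%:R).
  by congr nat_of_bool; apply/idP/eqP; rewrite inE.
under eq_bigr do rewrite E scaler_suml.
rewrite exchange_big/=; apply: eq_bigr => j _.
rewrite (bigD1_seq (t (y j))) ?fset_uniq//=; last first.
  rewrite in_fset_set; last exact: tP.1.
  by rewrite inE; exists (y j).
rewrite eqxx mulr1 big1 ?addr0 ?ht// => w; rewrite eq_sym => /negbTE ->.
by rewrite mulr0 scale0r.
Qed.

(** A point outside the support has a null open neighbourhood, hence a null
    ball from a countable family, since B is separable. *)
Lemma supp_null (zeta : probability (borel B) R) : separable B ->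
  exists N : set (borel B), [/\ measurable N, zeta N = 0%E & ~` supp zeta `<=` N].
Proof.
move=> /separable_dense_seq[e eP].
(* the countable family of balls with centre e j and radius 1 / (k + 1) *)
pose D (jk : nat * nat) : set B := ball (e jk.1) (jk.2.+1%:R^-1).
pose G n : set (borel B) := if @unpickle (nat * nat)%type n is Some jk then
  if zeta (D jk) == 0%E then D jk else set0 else set0.
have mD jk : measurable (D jk : set (borel B)).
  by apply: borel_open; apply: ball_open; rewrite invr_gt0.
have mG n : measurable (G n).
  by rewrite /G; case: unpickle => // jk; case: ifP.
exists (\bigcup_n G n); split.
- exact: bigcupT_measurable.
- apply/eqP; rewrite eq_le measure_ge0 andbT.
  have h := @measure_sigma_subadditive _ _ _ zeta (\bigcup_n G n) G mG
    (bigcupT_measurable _ mG) (fun x Gx => Gx).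
  apply: (le_trans h).
  rewrite eseries0// => n _ _; rewrite /G.
  by case: unpickle => [jk|]; [case: ifP => [/eqP//|_]|]; rewrite measure0.
- move=> x /= /existsNP[U /not_implyP[oU /not_implyP[Ux /negP]]].
  rewrite -leNgt => U0.
  have /nbhs_ballP[r /= r0 rU] : nbhs x U by exact: open_nbhs_nbhs.
  have [k kr] : exists k : nat, k.+1%:R^-1 < r / 2.
    have r20 : 0 < r / 2 by rewrite divr_gt0.
    have [N _ hN] := near_infty_natSinv_lt (PosNum r20).
    by exists N; exact: hN (leqnn N).
  have [j jx] : exists j, `|x - e j| < k.+1%:R^-1 by apply: eP; rewrite invr_gt0.
  have DU : D (j, k) `<=` U.
    move=> z; rewrite /D -ball_normE/= => jz; apply: rU; rewrite -ball_normE/=.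
    rewrite (le_lt_trans (ler_distD (e j) _ _))// [ltRHS]splitr ltrD//.
      exact: lt_trans kr.
    exact: lt_trans kr.
  exists (pickle (j, k)) => //; rewrite /G pickleK.
  have -> : zeta (D (j, k)) == 0%E.
    rewrite eq_le measure_ge0 andbT (le_trans _ U0)//.
    by apply: le_measure; rewrite ?inE//; exact: borel_open.
  by rewrite /D -ball_normE/= distrC.
Qed.

End atomic.

(** * Lipschitz convex test functions *)

Section convex_lipschitz.
Context (R : realType) (B : completeNormedModType R).

Lemma lipschitz_klip (F : B -> R^o) : lipschitz F -> exists2 L : R, 0 <= L & klip L F.
Proof.
move=> [M [_ FM]]; exists (`|M| + 1); first by rewrite addr_ge0.
move=> x y.
have MM : M < `|M| + 1 by rewrite (le_lt_trans (ler_norm _))// ltrDl.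
exact: (FM _ MM (x, y) (conj Logic.I Logic.I)).
Qed.

Lemma klip_lipschitz (F : B -> R^o) (L : R) : klip L F -> lipschitz F.
Proof.
move=> FL; exists L; split; first exact: num_real.
move=> M LM [x y] _ /=; apply: (le_trans (FL x y)).
by apply: ler_wpM2r => //; exact: ltW.
Qed.

Lemma convex_functionP (F : B -> R^o) : convex_function [set: B] F <-> convex_real F.
Proof.
split=> [h t x y /andP[t0 t1]|h t x y _ _].
  have := h (Itv01 t0 t1) x y; rewrite !inE => /(_ Logic.I Logic.I).
  by [].
apply: h; rewrite ?ge0 ?le1 //.
Qed.

End convex_lipschitz.

(** * Quantisations lie below in the convex order *)

Lemma card_range_le (I : finType) (X : choiceType) (y : I -> X) :
  (range y #<= `I_#|I|)%card.
Proof.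
have [m ym] := (finite_setP _).1 (finite_range y).
rewrite (card_le_eql ym) card_le_II -(card_fset_set ym) cardT -(size_map y).
apply: uniq_leq_size; first exact: fset_uniq.
move=> x; rewrite in_fset_set; last exact: finite_range.
by rewrite inE => -[i _ <-]; apply: map_f; rewrite mem_enum.
Qed.

Section quantisation.
Context (R : realType) (B : completeNormedModType R).
Hypothesis sepB : separable B.
Context (gamma : probability (borel B) R).
Hypothesis hgamma : finite_first_moment gamma.

Section marginal.
Context (pi : probability (borel (B * B)) R).
Hypothesis pi2 : second_marginal pi gamma.

Lemma marginal_norm : (\int[pi]_z (`|z.2|)%:E < +oo)%E.
Proof.
have mn : measurable_fun setT (fun y : borel B => (`|y : B|)%:E).
  by apply/measurable_EFinP; apply: continuous_borel_real => y; exact: norm_continuous.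
have := ge0_integral_pushforward (@measurable_borel_snd R B) pi
  (@measurableT _ (borel B)) mn.
move=> /(_ (fun _ _ => normr_ge0 _)); rewrite preimage_setT /= => E.
apply: le_lt_trans hgamma; rewrite le_eqVlt; apply/orP; left; apply/eqP.
apply: (etrans (esym E)); apply: eq_measure_integral.
  exact: measurable_borel_snd.
by move=> ? A mA _; exact: pi2.
Qed.

Lemma marginal_klip (F : B -> R) (L : R) : klip L F ->
  (\int[pi]_z (F z.2)%:E = \int[gamma]_y (F y)%:E)%E.
Proof.
move=> FL.
have mF : measurable_fun setT (fun y : borel B => (F y)%:E).
  by apply/measurable_EFinP; apply: continuous_borel_real; exact: klip_continuous FL.
have Fi := integrable_klip (mu := pi) measurableT FL (@measurable_borel_snd R B) marginal_norm.
have := integral_pushforward (@measurable_borel_snd R B) mF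
  (D := setT) Fi (@measurableT _ (borel B)).
rewrite preimage_setT => E; apply: (etrans (esym E)).
apply: eq_measure_integral; first exact: measurable_borel_snd.
by move=> ? A mA _; exact: pi2.
Qed.

Lemma bochner_barycentre (C : set (borel (B * B))) : measurable C ->
  is_bochner_integral pi C (snd : borel (B * B) -> B)
    (bochner_integral pi C (snd : borel (B * B) -> B)).
Proof.
move=> mC; have [e eP] := separable_dense_seq sepB.
apply: xgetPex; eexists.
exact: (bochner_mean eP (@measurable_borel_snd R B) marginal_norm mC).
Qed.

(** On a null cell both sides vanish, whatever the value of the barycentre. *)
Lemma jensen_cell (C : set (borel (B * B))) (F : B -> R) (L : R) : measurable C ->
  0 <= L -> klip L F -> convex_real F ->
  ((fine (pi C) * F (barycentre pi C))%:E <= \int[pi]_(z in C) (F z.2)%:E)%E.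
Proof.
move=> mC L0 FL Fcvx.
have [C0|C0] := eqVneq (pi C) 0%E.
  rewrite C0 mul0r null_set_integral//.
  apply/measurable_EFinP/measurable_funTS.
  exact: measurable_klip FL (@measurable_borel_snd R B).
have c0 : 0 < fine (pi C).
  by rewrite fine_gt0// lt0e C0 measure_ge0/= ltey_eq fin_num_measure.
have fi : (\int[pi]_(z in C) (`|z.2|)%:E < +oo)%E.
  apply: le_lt_trans marginal_norm; apply: ge0_subset_integral => //.
  apply/measurable_EFinP.
  exact: (measurable_normB (@measurable_borel_snd R B)).
have := jensen mC (@measurable_borel_snd R B) fi (bochner_barycentre mC) L0 FL Fcvx c0.
by apply: le_trans; rewrite EFinM fineK ?fin_num_measure.
Qed.

End marginal.

Lemma measurable_cell (P : set B) : measurable (P : set (borel B)) ->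
  measurable (P `*` setT : set (borel (B * B))).
Proof.
move=> mP; rewrite (_ : _ `*` _ = fst @^-1` P).
  rewrite -[X in measurable X]setTI.
  exact: (@measurable_borel_fst R B measurableT _ mP).
by apply/seteqP; split => [z []|z ?].
Qed.

Lemma quantisation_atoms (I : finType) (P1 : I -> set B)
    (pi : probability (borel (B * B)) R) (zeta : probability (borel B) R) :
  barycentric_quantisation gamma pi P1 (fun _ : unit => [set: B]) zeta ->
  forall A : set (borel B), measurable A -> zeta A =
    (\sum_i fine (pi (P1 i `*` setT)) *
      \1_A (barycentre pi (P1 i `*` setT)))%:E.
Proof.
move=> [_ _ _ [[_ mP1] _] zE] A mA; rewrite zE//.
rewrite big_mkcond/= -sumEFin.
rewrite (reindex (fun i : I => (i, tt)))/=; last first.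
  by exists fst => [//|[i []]].
apply: eq_bigr => i _; case: ifPn => [_|].
  rewrite diracE EFinM indicE fineK// fin_num_measure//.
  exact: measurable_cell.
rewrite -leNgt => pi0.
have -> : pi (P1 i `*` setT) = 0%E by apply/eqP; rewrite eq_le pi0 measure_ge0.
by rewrite mul0r.
Qed.

Lemma quantisation_P_cx (n : nat) (I : finType) (P1 : I -> set B)
    (pi : probability (borel (B * B)) R) (zeta : probability (borel B) R) :
  (#|I| <= n)%N ->
  barycentric_quantisation gamma pi P1 (fun _ : unit => [set: B]) zeta ->
  P_cx n gamma zeta.
Proof.
move=> In Q; have zE := quantisation_atoms Q.
have [_ [zeta1 _] pi2 [[[P1T tP1 _] mP1] _] _] := Q.
split=> //.
- apply: (@card_le_trans _ _ _ (range (fun i => barycentre pi (P1 i `*` setT)))).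
    apply: subset_card_le => x /= xsupp; apply: contrapT => nx.
    have oY : open (~` range (fun i => barycentre pi (P1 i `*` setT))).
      by apply: closed_openC; apply: closed_finite_set; exact: finite_range.
    have := xsupp _ oY nx; rewrite zE; last exact: borel_open.
    rewrite big1 ?ltxx// => i _; rewrite indicE memNset ?mulr0//.
    by apply; exists i.
  apply: (card_le_trans (card_range_le _)).
  by rewrite card_le_II.
- move=> F Flip /convex_functionP Fcvx.
  have [L L0 FL] := lipschitz_klip Flip.
  rewrite (integral_atomic zE); last first.
    by apply: continuous_borel_real; exact: klip_continuous FL.
  rewrite -(marginal_klip pi2 FL).
  have cover x : exists i, P1 i x.
    have [i _ Pix] : cover setT P1 x by rewrite P1T.
    by exists i.
  have [S SP] := choice (fun z : borel (B * B) => cover z.1).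
  have SE i : S @^-1` [set i] = P1 i `*` setT.
    apply/seteqP; split => [z /= <-|z [/= Pz _]]; first by split.
    by apply: (tP1 (S z) i) => //; exists z.1.
  have mS i : measurable (S @^-1` [set i]).
    by rewrite SE; exact: measurable_cell.
  rewrite (integral_finType_partition _ mS); last first.
    exact: measurable_klip FL (@measurable_borel_snd R B).
  rewrite -sumEFin; apply: lee_sum => i _; rewrite SE.
  by apply: jensen_cell pi2 _ _ _ _ L0 FL Fcvx; rewrite -SE.
Qed.

End quantisation.

(** * Measures below in the convex order are quantisations *)

Section converse.
Context (R : realType) (B : completeNormedModType R).
Hypothesis sepB : separable B.

(** Each atom has positive mass because a neighbourhood of it meets the finite
    support in no other point. *)
Lemma finite_supp_atoms (n : nat) (zeta : probability (borel B) R) :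
  (supp zeta #<= `I_n)%card -> exists (m : nat) (v : 'I_m.+1 -> B),
  [/\ (m.+1 <= n)%N, injective v,
      forall i, 0 < fine (zeta ([set v i] : set (borel B))) &
      forall A : set (borel B), measurable A ->
        zeta A = (\sum_i fine (zeta ([set v i] : set (borel B))) * \1_A (v i))%:E].
Proof.
move=> suppn.
have fS : finite_set (supp zeta) by apply/finite_set_leP; exists n.
have [N [mN N0 suppN]] := supp_null zeta sepB.
have mS := borel_finite_set fS.
have zS (A : set (borel B)) : measurable A -> (A : set B) `&` supp zeta = set0 ->
    zeta A = 0%E.
  move=> mA AS; apply/eqP; rewrite eq_le measure_ge0 andbT -N0.
  apply: le_measure; rewrite ?inE// => x Ax; apply: suppN => Sx.
  by have : ((A : set B) `&` supp zeta) x by []; rewrite AS.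
pose r : seq B := fset_set (supp zeta).
have rS x : x \in r <-> supp zeta x.
  by rewrite /r in_fset_set// inE.
have rn : (size r <= n)%N by exact: geq_card_fset_set suppn.
have ru : uniq r by exact: fset_uniq.
have r0 : (0 < size r)%N.
  rewrite lt0n; apply/negP => /nilP r0.
  have := zS setT measurableT; rewrite probability_setT => /(_ _)/eqP.
  rewrite onee_eq0 => h; suff: false by []; apply: h.
  by apply/seteqP; split => // x [_ /rS]; rewrite r0.
pose m := (size r).-1.
have mr : m.+1 = size r by rewrite prednK.
pose v (i : 'I_m.+1) := nth 0 r i.
have vS i : supp zeta (v i).
  by apply/rS/mem_nth; rewrite -mr.
have vinj : injective v.
  move=> i j /eqP; rewrite nth_uniq// -?mr// => /eqP; exact: val_inj.
have Sv x : supp zeta x -> exists i, v i = x.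
  move=> /rS xr; have xm : (index x r < m.+1)%N by rewrite mr index_mem.
  by exists (Ordinal xm); rewrite /v nth_index.
exists m, v; split=> //; first by rewrite mr.
- move=> i; have mvi := @borel_set1 R B (v i).
  rewrite fine_gt0// ltey_eq fin_num_measure// andbT.
  pose U : set B := ~` (supp zeta `\ v i).
  have oU : open U.
    by apply: closed_openC; apply: closed_finite_set; exact: finite_setD.
  have Uvi : U (v i) by move=> [_]; apply.
  have mU := borel_open oU.
  have mD : measurable (U `\ v i : set (borel B)) by exact: measurableD.
  have UE : U = [set v i] `|` (U `\ v i).
    by rewrite setDUK// => _ ->.
  have := vS i _ oU Uvi; rewrite {1}UE measureU ?setDIK//.
  rewrite [X in _ + X](zS _ mD) ?adde0//.
  apply/seteqP; split => // x [[Ux xv] Sx]; exact: Ux.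
- move=> A mA.
  have zP : finadd (fun C : set (borel B) => fine (zeta (A `&` C))).
    exact: finadd_measure.
  have mv i : measurable ([set v i] : set (borel B)) by exact: borel_set1.
  have vU : \big[setU/set0]_i [set v i] = supp zeta.
    rewrite -bigcup_seq; apply/seteqP; split => [x [i _ ->]//|x /Sv[i <-]].
    by exists i => //=; rewrite mem_index_enum.
  have /= := finadd_bigsetU zP mv (index_enum_uniq _) _; rewrite vU => h.
  rewrite -[LHS]fineK ?fin_num_measure//; congr EFin.
  rewrite -[in LHS](setIT A) -(setUv (supp zeta)) setIUr measureU; last 3 first.
  + exact: measurableI.
  + by apply: measurableI => //; exact: measurableC.
  + by rewrite setIACA setICr setI0.
  rewrite [X in (_ + X)%E](zS _ _) ?adde0; last 2 first.
  + by apply: measurableI => //; exact: measurableC.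
  + by rewrite -setIA setICl setI0.
  rewrite h; last by move=> i j _ _ [x [/= -> /vinj]].
  apply: eq_bigr => i _; rewrite indicE.
  have [vA|vA] := boolP (v i \in A).
    rewrite mulr1 (_ : A `&` [set v i] = [set v i])//.
    by apply/seteqP; split => [x []//|x ->]; split => //; exact/set_mem.
  rewrite mulr0 (_ : A `&` [set v i] = set0) ?measure0//.
  apply/seteqP; split => // x [Ax xv]; move: vA; rewrite -xv.
  by move/negP; apply; exact/mem_set.
Qed.

Lemma mean_snd (e : nat -> B) (nu : set (borel B) -> R)
    (nu' : set (borel (B * B)) -> R) :
  (forall A : set (borel B), measurable A ->
    nu' ((snd : borel (B * B) -> borel B) @^-1` A) = nu A) ->
  mean e (snd : borel (B * B) -> B) nu' = mean e (idfun : borel B -> B) nu.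
Proof.
move=> nu'E; rewrite /mean; congr (lim (_ @ \oo)); apply/funext => k.
rewrite /csum.
have E : range (nearest e k \o (snd : borel (B * B) -> B)) =
    range (nearest e k \o (idfun : borel B -> B)).
  apply/seteqP; split => [_ [z _ <-]|_ [x _ <-]]; first by exists z.2.
  by exists (x, x).
rewrite E; apply: eq_fsbigr => w _; congr (_ *: _).
by rewrite comp_preimage nu'E//; exact: (nearest_finitary e k).2.
Qed.

(** The cells of the partition are the singletons of the atoms, except that the
    complement of all atoms is added to the first cell. *)
Lemma P_cx_quantisation (n : nat) (gamma zeta : probability (borel B) R) :
  finite_first_moment gamma -> P_cx n gamma zeta ->
  exists (I : finType) (P1 : I -> set B) (pi : probability (borel (B * B)) R),
    (#|I| <= n)%N /\
    barycentric_quantisation gamma pi P1 (fun _ : unit => [set: B]) zeta.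
Proof.
move=> hgamma [zeta1 suppn cx].
have [m [v [mn vinj p_gt0 zE]]] := finite_supp_atoms suppn.
have [e eP] := separable_dense_seq sepB.
pose p i := fine (zeta ([set v i] : set (borel B))).
have idm : measurable_fun setT (idfun : borel B -> borel B).
  by move=> _ A mA; rewrite setTI; exact: mA.
have [||nu [nuP nuE]] := strassen (mu := gamma) eP idm hgamma ord0 (p := p) (v := v).
- by move=> i; exact: ltW (p_gt0 i).
- move=> F L L0 FL Fcvx; rewrite -(integral_atomic zE).
    by apply: cx; [exact: klip_lipschitz FL|apply/convex_functionP].
  by apply: continuous_borel_real; exact: klip_continuous FL.
have [pi piE] := coupling v nuP.
(* points that are no atom are sent to the first index *)
pose S (x : borel B) := odflt ord0 [pick i | v i == x].
have SP : finitary S := finitary_comp (odflt ord0) (finitary_pick v).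
have Sv i : S (v i) = i.
  by rewrite /S; case: pickP => [j /eqP/vinj//|/(_ i)]; rewrite eqxx.
pose P1 i : set B := S @^-1` [set i].
have nuT i : nu i setT = p i by exact: (nuE i).1.
have piC i (A : set (borel B)) : measurable A ->
    pi (P1 i `*` [set: B] `&` (snd : borel (B * B) -> borel B) @^-1` A) = (nu i A)%:E.
  move=> mA; rewrite piE; last first.
    apply: measurableI; first by apply: measurable_cell; exact: SP.2.
    by rewrite -[X in measurable X]setTI; exact: (@measurable_borel_snd R B measurableT _ mA).
  congr EFin; rewrite (bigD1 i)//= big1 ?addr0 => [|j ji].
    congr nu; apply/seteqP; split => [y [_]//|y Ay]; split => //; split => //.
    exact: Sv.
  rewrite (_ : _ @^-1` _ = set0); first exact: finadd0 (nuP.1 j).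
  by apply/seteqP; split => // y [[/= Sji _] _]; rewrite -Sji Sv eqxx in ji.
have pi2 : second_marginal pi gamma.
  move=> A mA; rewrite /pushforward piE; last first.
    by rewrite -[X in measurable X]setTI; exact: (@measurable_borel_snd R B measurableT _ mA).
  rewrite -[RHS]fineK ?fin_num_measure//; congr EFin.
  exact: (nuP.2 A mA).
have pi1 i : pi (P1 i `*` setT) = (p i)%:E.
  by rewrite -nuT -piC// preimage_setT setIT.
have bar i : barycentre pi (P1 i `*` setT) = v i.
  have mC : measurable (P1 i `*` setT : set (borel (B * B))).
    by apply: measurable_cell; exact: SP.2.
  have := bochner_mean eP (@measurable_borel_snd R B) (marginal_norm hgamma pi2) mC.
  move=> /(bochner_integral_eq mC (@measurable_borel_snd R B)).
  rewrite (@mean_snd e (nu i)) => [|A mA]; last exact: (congr1 fine (piC i A mA)).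
  rewrite (nuE i).2 /barycentre => ->; rewrite pi1 scalerA mulVf ?scale1r//.
  by rewrite gt_eqF//; exact: p_gt0.
exists 'I_m.+1, P1, pi; rewrite card_ord; split=> //; split => //.
- split=> //; apply/finite_set_leP; exists n; exact: suppn.
- split; split.
  + split.
    * by apply/seteqP; split => // x _; exists (S x).
    * by move=> i j _ _ [x [<- <-]].
    * by move=> i _; exists (v i); exact: Sv.
  + by move=> i; exact: SP.2.
  + split.
    * by apply/seteqP; split => // x _; exists tt.
    * by move=> [] [].
    * by move=> _ _; exists 0.
  + by move=> _; exact: measurableT.
- move=> A mA; rewrite zE// [RHS]big_mkcond/= -sumEFin.
  rewrite [RHS](reindex (fun i : 'I_m.+1 => (i, tt)))/=; last first.
    by exists fst => [//|[i []]].
  apply: eq_bigr => i _; rewrite pi1 lte_fin p_gt0.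
  by rewrite bar diracE EFinM.
Qed.

End converse.

Theorem proposition38 (R : realType) (B : completeNormedModType R)
    (sepB : separable B) (gamma : probability (borel B) R)
    (hgamma : finite_first_moment gamma) (n : nat) (hn : (1 <= n)%N) :
  P_cx n gamma =
  [set zeta : probability (borel B) R |
    exists (I : finType) (P1 : I -> set B)
           (pi : probability (borel (B * B)) R),
      (#|I| <= n)%N /\
      barycentric_quantisation gamma pi P1 (fun _ : unit => [set: B]) zeta].
Proof.
apply/seteqP; split => [zeta|zeta [I [P1 [pi [In Q]]]]].
  exact: P_cx_quantisation.
exact: quantisation_P_cx In Q.
Qed.
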